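(* Let $\theta>0$, let $\mathcal{L}$ be a probability distribution on $\mathbb{C}^*$, and let $(M_N)_{N\ge 1}$ be a sequence of random matrices following the law $\mathbb{P}(\infty,\theta,\mathcal{L})$. Suppose that if $Z$ is a random variable with distribution $\mathcal{L}$, then $\log|Z|$ is integrable. Then, almost surely, the probability measure $\mu(M_N)/N$ converges weakly, as $N\to\infty$, to the uniform distribution on the circle of center zero and radius $\exp(\mathbb{E}[\log|Z|])$.
   Context: $\Sigma_N$ is the group of permutations of $\{1,\dots,N\}$. For $\sigma\in\Sigma_N$ and $z_1,\dots,z_N\in\mathbb{C}^*$, $M(\sigma,z_1,\dots,z_N)$ is the $N\times N$ matrix $M$ with entries $M_{jk}=z_j\mathbf{1}_{j=\sigma(k)}$. For such a matrix $M$, $\mu(M)=\sum_{\lambda} m_M(\lambda)\delta_\lambda$, the sum being over the eigenvalues $\lambda$ of $M$, with $m_M(\lambda)$ the multiplicity of $\lambda$ as eigenvalue of $M$. The Ewens measure of parameter $\theta>0$ on $\Sigma_N$ gives each permutation $\sigma$ a probability proportional to $\theta^{n}$, where $n$ is the number of cycles of $\sigma$. A virtual permutation is a sequence $(\sigma_N)_{N\ge1}$ with $\sigma_N\in\Sigma_N$ such that for all $N\ge1$ the cycle structure of $\sigma_N$ is obtained from that of $\sigma_{N+1}$ by removing the element $N+1$ from its cycle. The Ewens measure of parameter $\theta$ on virtual permutations is the unique probability measure under which, for every $N$, $\sigma_N$ follows the Ewens($\theta$) measure on $\Sigma_N$. $\mathbb{P}(\infty,\theta,\mathcal{L})$ is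 the law of the sequence $(M_N)_{N\ge1}$ with $M_N=M(\sigma_N,z_1,\dots,z_N)$, where $(\sigma_N)_{N\ge1}$ is a random virtual permutation following the Ewens($\theta$) measure, $(z_j)_{j\ge1}$ are i.i.d. random variables with law $\mathcal{L}$, and $(z_j)_{j\ge 1}$ is independent of $(\sigma_N)_{N\ge1}$. *)

(* Defs.v *)
From HB Require Import structures.
From mathcomp Require Import all_boot all_order all_algebra all_fingroup.
From mathcomp Require Import finmap complex.
From mathcomp Require Import all_classical all_reals all_analysis.
From mathcomp Require Import measurable_realfun.

Set Implicit Arguments.
Unset Strict Implicit.
Unset Printing Implicit Defensive.

Import Order.TTheory GRing.Theory Num.Theory numFieldNormedType.Exports.
Import ComplexField.Normc.

Local Open Scope classical_set_scope.
Local Open Scope ring_scope.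

(* [R[i]] gets the topology of its own modulus and the Borel sigma-algebra. *)
HB.instance Definition _ (R : realType) := NormedModule.copy R[i] R[i]^o.
HB.instance Definition _ (R : realType) :=
  Measurable.copy R[i] (g_sigma_algebraType (@open R[i])).

(* Matrices of size N >= 1 are written with N = n.+1. *)

Definition cycle_mx (R : realType) (N : nat) (s : 'S_N) (z : 'I_N -> R[i]) :
    'M[R[i]]_N :=
  \matrix_(j, k) (z j *+ (j == s k)).

Definition spectral_measure (R : realType) (N : nat) (M : 'M[R[i]]_N)
    (A : set R[i]) : \bar R :=
  (\sum_(l \in [set l | eigenvalue M l])
    (mup l (char_poly M))%:R%:E * @dirac _ _ l R A)%E.

Section spectral_measure_is_measure.
Variables (R : realType) (N : nat) (M : 'M[R[i]]_N).

Let eigs : seq R[i] := sval (closed_field_poly_normal (char_poly M)).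

Let char_polyE : char_poly M = \prod_(z <- eigs) ('X - z%:P).
Proof.
rewrite /eigs; case: closed_field_poly_normal => s /= {1}->.
by rewrite (monicP (char_poly_monic M)) scale1r.
Qed.

Let size_eigs : size eigs = N.
Proof.
have := size_char_poly M.
by rewrite char_polyE size_prod_XsubC => -[].
Qed.

Let spectral_measureE A :
  spectral_measure M A = (\sum_(l <- eigs) @dirac _ _ l R A)%E.
Proof.
rewrite /spectral_measure.
have -> : [set l | eigenvalue M l] = [set` undup eigs].
  apply/seteqP; split=> l /=;
  by rewrite eigenvalue_root_char char_polyE root_prod_XsubC mem_undup.
rewrite -fsbig_seq ?undup_uniq// -[RHS]big_undup_iterop_count.
apply: eq_bigr => l _; rewrite char_polyE mu_prod_XsubC /dirac.
elim: (count_mem l eigs) => [|n IH]; first by rewrite mul0e.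
rewrite [RHS]Monoid.iteropE iterS -Monoid.iteropE -IH -!EFinM.
by rewrite -natr1 mulrDl mul1r addrC EFinD.
Qed.

Let spectral_measure_msum :
  spectral_measure M = msum (fun k => dirac (nth 0 eigs k)) (size eigs).
Proof.
by apply/funext => A; rewrite spectral_measureE /msum (big_nth 0) big_mkord.
Qed.

Let spectral0 : spectral_measure M set0 = 0%E.
Proof. by rewrite spectral_measure_msum measure0. Qed.

Let spectral_ge0 A : (0 <= spectral_measure M A)%E.
Proof. by rewrite spectral_measure_msum measure_ge0. Qed.

Let spectral_sigma_additive : semi_sigma_additive (spectral_measure M).
Proof.
by rewrite spectral_measure_msum; exact: measure_semi_sigma_additive.
Qed.

HB.instance Definition _ := isMeasure.Build _ _ _ (spectral_measure M)
  spectral0 spectral_ge0 spectral_sigma_additive.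

Lemma spectral_measure_setT : spectral_measure M setT = N%:R%:E.
Proof.
rewrite spectral_measureE.
under eq_bigr do rewrite diracT.
by rewrite sumEFin big_const_seq count_predT size_eigs iter_addr_0.
Qed.

End spectral_measure_is_measure.

Definition spectral_prob (R : realType) (n : nat) (M : 'M[R[i]]_n.+1) :
    set R[i] -> \bar R :=
  mscale (n.+1%:R^-1)%:nng (spectral_measure M).

HB.instance Definition _ (R : realType) n (M : 'M[R[i]]_n.+1) :=
  Measure.on (spectral_prob M).

Lemma spectral_prob_setT (R : realType) n (M : 'M[R[i]]_n.+1) :
  spectral_prob M setT = 1%E.
Proof.
by rewrite /spectral_prob /mscale/= spectral_measure_setT -EFinM mulVf.
Qed.

HB.instance Definition _ (R : realType) n (M : 'M[R[i]]_n.+1) :=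
  Measure_isProbability.Build _ _ _ (spectral_prob M) (spectral_prob_setT M).

Definition circle_param (R : realType) (r : R) (t : measurableTypeR R) : R[i] :=
  ((r * cos t) +i* (r * sin t))%C.

Lemma continuous_real_complex (R : realType) :
  continuous (fun x : R => x%:C%C : R[i]).
Proof.
move=> x; apply/cvgrPdist_lt => -[e1 e2].
rewrite ltcE/= => /andP[/eqP -> e0]; near=> y.
rewrite -raddfB/= normc_def/= expr0n addr0 sqrtr_sqr ltcR.
by near: y; exists e1.
Unshelve. all: by end_near. Qed.

Lemma continuous_circle_param (R : realType) (r : R) :
  continuous (circle_param r).
Proof.
have -> : circle_param r =
    (fun t => (r * cos t)%:C%C + 'i%C * (r * sin t)%:C%C).
  by apply/funext => t; rewrite /circle_param; simpc.
move=> t; apply: cvgD.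
  apply: (@continuous_comp _ _ _ (fun t => r * cos t) (fun x : R => x%:C%C)).
    by apply: cvgM; [exact: cvg_cst|exact: continuous_cos].
  exact: continuous_real_complex.
apply: cvgM; first exact: cvg_cst.
apply: (@continuous_comp _ _ _ (fun t => r * sin t) (fun x : R => x%:C%C)).
  by apply: cvgM; [exact: cvg_cst|exact: continuous_sin].
exact: continuous_real_complex.
Qed.

Lemma measurable_circle_param (R : realType) (r : R) :
  measurable_fun setT (circle_param r).
Proof.
apply: (@measurability _ _ _ _ setT _ (@open R[i])) => //.
move=> _ [A oA <-]; rewrite setTI; apply: open_measurable.
apply: open_comp oA => t _; exact: continuous_circle_param.
Qed.

HB.instance Definition _ (R : realType) (r : R) :=
  isMeasurableFun.Build _ _ _ _ (circle_param r) (measurable_circle_param r).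

Lemma lt0_2pi (R : realType) : 0 < 2 * pi :> R.
Proof. by rewrite mulr_gt0// pi_gt0. Qed.

Definition uniform_circle (R : realType) (r : R) : probability R[i] R :=
  distribution (uniform_prob (lt0_2pi R)) (circle_param r).

Definition weak_cvg (R : realType) (mu : nat -> probability R[i] R)
    (nu : probability R[i] R) : Prop :=
  forall f : R[i] -> R, continuous f -> bounded_fun f ->
    (\int[mu n]_x (f x)%:E)%E @[n --> \oo] --> (\int[nu]_x (f x)%:E)%E.

Definition ewens (R : realType) (theta : R) (N : nat) (s : 'S_N) : R :=
  theta ^+ #|porbits s| / \sum_(t : 'S_N) theta ^+ #|porbits t|.

(* Deleting the last point from its cycle: its predecessor is sent to its
   successor, and the other values are unchanged. *)
Definition virtual_perm (s : forall n, 'S_n.+1) : Prop :=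
  forall n (i : 'I_n.+1),
    let w := widen_ord (leqnSn n.+1) in
    w (s n i) = if s n.+1 (w i) == ord_max then s n.+1 ord_max
                else s n.+1 (w i).

Section independence.
Context d (T : measurableType d) (R : realType) (P : probability T R).

Definition mutually_independent (I : choiceType) (F : I -> set (set T)) :
    Prop :=
  forall (J : {fset I}) (E : I -> set T), (forall j, j \in J -> F j (E j)) ->
    P (\bigcap_(j in [set` J]) E j) = (\prod_(j <- J) P (E j))%E.

Definition independent (F G : set (set T)) : Prop :=
  forall A B, F A -> G B -> P (A `&` B) = (P A * P B)%E.

End independence.

(* [sigma n] and [z j] stand for sigma_(n+1) and z_(j+1). A law on C^* is
   represented by a Borel law [L] on C with [L [set 0] = 0]. *)
Record ewens_model (R : realType) (theta : R) (L : probability R[i] R)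
    d (T : measurableType d) (P : probability T R)
    (sigma : forall n, T -> 'S_n.+1) (z : nat -> {RV P >-> R[i]}) : Prop := {
  ewens_model_measurable : forall n s, measurable [set w | sigma n w = s];
  ewens_model_virtual : forall w, virtual_perm (sigma ^~ w);
  ewens_model_sigma :
    forall n s, P [set w | sigma n w = s] = (ewens theta s)%:E;
  ewens_model_neq0 : forall j w, z j w != 0;
  ewens_model_z :
    forall j A, measurable A -> distribution P (z j) A = L A;
  ewens_model_z_indep :
    mutually_independent P
      (fun j => preimage_set_system setT (z j) measurable);
  ewens_model_indep :
    independent P
      <<s \bigcup_n preimage_set_system setT (sigma n) setT >>
      <<s \bigcup_j preimage_set_system setT (z j) measurable >>
}.

Arguments ewens_model {R} theta L {d T} P sigma z.

(* The space of sequences of matrices, with the sigma-algebra generated by the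
   entries. *)
Definition mx_cylinders (R : realType) :
    set (set (forall n, 'M[R[i]]_n.+1)) :=
  [set C | exists n i j (B : set R[i]),
     measurable B /\ C = [set M : forall n, 'M[R[i]]_n.+1 | B (M n i j)]].

Definition mxseq (R : realType) := g_sigma_algebraType (@mx_cylinders R).

Definition ewens_mx_law (R : realType) (theta : R) (L : probability R[i] R)
    (Q : probability (mxseq R) R) : Prop :=
  exists d (T : measurableType d) (P : probability T R)
      (sigma : forall n, T -> 'S_n.+1) (z : nat -> {RV P >-> R[i]}),
    ewens_model theta L P sigma z /\
    forall A : set (mxseq R), measurable A ->
      Q A = P [set w | A (fun n => cycle_mx (sigma n w) (fun j => z j w))].

(* Main.v *)
Require Import Defs.
From mathcomp Require Import all_boot all_order all_algebra all_fingroup.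
From mathcomp Require Import finmap complex ring lra.
From mathcomp Require Import all_classical all_reals all_analysis.
From mathcomp Require Import measurable_realfun.

Set Implicit Arguments.
Unset Strict Implicit.
Unset Printing Implicit Defensive.

Import Order.TTheory GRing.Theory Num.Theory numFieldNormedType.Exports.
Import ComplexField.Normc HBNNSimple.

Local Open Scope classical_set_scope.
Local Open Scope ring_scope.

(** Write m for E log|Z| and X_j for log|z_j| - m. The spectrum of a weighted
    permutation matrix splits along the cycles of the permutation: a cycle c
    of length l contributes the l-th roots of the product of its weights
    ([char_poly_cycle_mx], [cycle_mx_eigenvalues]). These roots lie on the
    circle of radius exp(m + S_c / l), where S_c is the sum of X_j over c, and
    they have one argument in each of the l arcs of length 2 pi / l. If l is
    large and S_c / l is small, the average over these roots of a bounded
    continuous function is therefore close to its average over the circle of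
    radius exp m ([riemann_sum_uniform], [polar_uniform_continuity]).

    Cycles that are short, or have large |S_c| / l, are negligible as soon as
    both (number of cycles) / N and (sum over c of |S_c|) / N tend to 0:
    a cycle with l <= a costs at most a, and one with |S_c| > del * l costs at
    most |S_c| / del, in a total mass of N. Hence the deterministic criterion
    [cvg_spectral_integral].

    The two conditions hold almost surely by Borel-Cantelli, from bounds on
    the probabilities of exceptional events that are summable in N. Under the
    Ewens measure the generating function of the number of cycles is a product
    of affine factors ([sum_exp_porbits]), whence E[2 ^ cycles] grows slower
    than any exponential ([ewens_exp2_porbits_le]); this settles the first
    condition ([ae_card_porbits_le]). For the second one X is cut at a level K
    ([ae_cycle_sums_le]). For the bounded part, the sum over c of |S_c| is a
    maximum of signed sums over the 2 ^ cycles choices of a sign for each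
    cycle; given the permutation each of them obeys an exponential bound, and
    the number of choices is absorbed by the previous estimate
    ([prob_cycle_sums_le], [ae_ewens]). The remaining part is bounded by a sum
    over all indices j < N of independent nonnegative variables with small
    expectation, for which a one-sided law of large numbers along the powers
    of 2 suffices ([ae_sum_iid_le]).

    Finally the two conditions cut out a measurable set of sequences of
    matrices ([concentrating], [measurable_concentrating]), because the
    permutation and the weights can be read off the entries; so the statement
    proved for one model passes to every sequence with the same law. *)

(** * Positions of points along the cycles of a permutation *)

Section CyclePositions.
Variables (T : finType) (s : {perm T}).
Implicit Types x y : T.

(** A point that depends only on the cycle of [x], from which the points of
    this cycle are numbered. *)
Definition cycle_root x := odflt x [pick y in porbit s x].

Definition cycle_pos x := index x (traject s (cycle_root x) #|porbit s x|).

Lemma mem_cycle_root x : cycle_root x \in porbit s x.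
Proof. by rewrite /cycle_root; case: pickP => //= _; rewrite porbit_id. Qed.

Lemma porbit_root x : porbit s (cycle_root x) = porbit s x.
Proof. by apply/eqP; rewrite eq_porbit_mem mem_cycle_root. Qed.

Lemma eq_cycle_root x y : y \in porbit s x -> cycle_root y = cycle_root x.
Proof.
rewrite -eq_porbit_mem => /eqP e; rewrite /cycle_root e.
by case: pickP => //= /(_ x); rewrite porbit_id.
Qed.

Lemma eq_porbit x y : y \in porbit s x -> porbit s y = porbit s x.
Proof. by rewrite -eq_porbit_mem => /eqP. Qed.

Lemma ltn_cycle_pos x : (cycle_pos x < #|porbit s x|)%N.
Proof.
rewrite /cycle_pos -[X in (_ < X)%N](size_traject s (cycle_root x)) index_mem.
by rewrite -porbit_root -porbit_traject porbit_root porbit_id.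
Qed.

Lemma iter_cycle_pos x : iter (cycle_pos x) s (cycle_root x) = x.
Proof.
rewrite -(nth_traject s (ltn_cycle_pos x)) nth_index//.
by rewrite -porbit_root -porbit_traject porbit_root porbit_id.
Qed.

Lemma iter_in_porbit a x : iter a s (cycle_root x) \in porbit s x.
Proof. by rewrite -permX -porbit_root mem_porbit. Qed.

Lemma cycle_pos_iter x a : (a < #|porbit s x|)%N ->
  cycle_pos (iter a s (cycle_root x)) = a.
Proof.
move=> al; rewrite /cycle_pos (eq_cycle_root (iter_in_porbit a x)).
rewrite (eq_porbit (iter_in_porbit a x)) -(nth_traject s al) index_uniq//.
  by rewrite size_traject.
by rewrite -porbit_root uniq_traject_porbit.
Qed.

Lemma big_porbit (R : Type) (idx : R) (op : Monoid.com_law idx) (F : T -> R) x :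
  \big[op/idx]_(y in porbit s x) F y =
  \big[op/idx]_(a < #|porbit s x|) F (iter a s (cycle_root x)).
Proof.
rewrite -porbit_root (eq_bigl _ _ (porbit_traject s (cycle_root x))).
rewrite -big_uniq ?uniq_traject_porbit//=.
rewrite (big_nth (cycle_root x)) big_mkord size_traject.
by apply: eq_bigr => i _; rewrite nth_traject.
Qed.

Lemma cycle_posS x : ((cycle_pos x).+1 < #|porbit s x|)%N ->
  cycle_pos (s x) = (cycle_pos x).+1.
Proof.
move=> lt; rewrite -{1}(iter_cycle_pos x) -iterS.
by rewrite cycle_pos_iter.
Qed.

Lemma cycle_rootS x : cycle_root (s x) = cycle_root x.
Proof. by apply: eq_cycle_root; rewrite -(expg1 s) mem_porbit. Qed.

Lemma porbitS x : porbit s (s x) = porbit s x.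
Proof. by rewrite -{2}(expg1 s) porbit_perm. Qed.

Lemma cycle_last x : ((cycle_pos x).+1 = #|porbit s x|)%N ->
  s x = cycle_root x.
Proof.
move=> e; rewrite -{1}(iter_cycle_pos x) -iterS e -porbit_root.
exact: iter_porbit.
Qed.

Lemma cycle_pos_root x : cycle_pos (cycle_root x) = 0%N.
Proof.
rewrite -[X in cycle_pos X]/(iter 0 s _) cycle_pos_iter//.
by rewrite lt0n card_porbit_neq0.
Qed.

Lemma cycle_pos_inj x y : y \in porbit s x -> cycle_pos y = cycle_pos x -> y
  = x.
Proof.
move=> yx e; rewrite -(iter_cycle_pos y) -(iter_cycle_pos x) e.
by rewrite (eq_cycle_root yx).
Qed.

End CyclePositions.

(** * The characteristic polynomial of a weighted permutation matrix *)

Lemma char_poly_similar (F : fieldType) (N : nat) (A B V W : 'M[F]_N) :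
  W *m V = 1%:M -> A *m V = V *m B -> char_poly A = char_poly B.
Proof.
move=> WV AV.
have VA : char_poly_mx A *m map_mx polyC V = map_mx polyC V *m char_poly_mx B.
  rewrite /char_poly_mx mulmxBl mulmxBr -!map_mxM AV.
  by rewrite mul_scalar_mx mul_mx_scalar.
have detV : \det (map_mx polyC V) != 0 :> {poly F}.
  rewrite det_map_mx polyC_eq0; apply/eqP => V0.
  have := congr1 determinant WV; rewrite det_mulmx V0 mulr0 det1 => /eqP.
  by rewrite eq_sym oner_eq0.
apply: (mulIf detV); rewrite /char_poly -det_mulmx VA det_mulmx mulrC//.
Qed.

(** An explicit basis of eigenvectors: on the cycle of [k], going one step
    further along the cycle multiplies the coordinate by the weight met and
    divides it by [lam k]. The choice of [lam] is free except that it must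
    list, without repetition, all the roots attached to each cycle. *)
Section CharPoly.
Variables (F : numFieldType) (N : nat) (s : 'S_N) (z : 'I_N -> F).
Variable lam : 'I_N -> F.
Hypothesis z_neq0 : forall j, z j != 0.
Hypothesis lamX : forall k,
  lam k ^+ #|porbit s k| = \prod_(j in porbit s k) z j.
Hypothesis lam_inj : forall k k', k' \in porbit s k -> lam k' = lam k -> k' = k.

(** The product of the weights met between the root of the cycle and [j]. *)
Let u (j : 'I_N) : F :=
  \prod_(a < cycle_pos s j) z (iter a.+1 s (cycle_root s j)).

Let u_neq0 j : u j != 0.
Proof. by apply/prodf_neq0 => a _. Qed.

Let lam_neq0 k : lam k != 0.
Proof.
have /prodf_neq0/negPf : forall j, j \in porbit s k -> z j != 0 by [].
rewrite -lamX; apply: contraFneq => ->.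
by rewrite expr0n (negPf (card_porbit_neq0 _ _)).
Qed.

Let V := \matrix_(j, k) (if j \in porbit s k
                           then u j * lam k ^- cycle_pos s j else 0).
Let W := \matrix_(k, j) (if j \in porbit s k
             then #|porbit s k|%:R^-1 * lam k ^+ cycle_pos s j / u j else 0).

Let eigenV i k : z (s i) * V i k = lam k * V (s i) k.
Proof.
rewrite !mxE -[in RHS]eq_porbit_mem porbitS eq_porbit_mem.
case: ifP => [ik|_]; last by rewrite !mulr0.
have [lt|] := ltnP (cycle_pos s i).+1 #|porbit s i|.
  rewrite /u (cycle_posS lt) cycle_rootS big_ord_recr/= exprS invfM.
  rewrite iter_cycle_pos; set w := \prod_(_ < _) _; set m := lam k ^+ _.
  have m0 : m != 0 by rewrite expf_neq0.
  by field; rewrite m0 lam_neq0.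
(* The step that closes the cycle: it uses [lam k ^+ l = \prod z]. *)
rewrite leq_eqVlt ltnNge ltn_cycle_pos orbF => /eqP/esym lE.
rewrite cycle_last// /u cycle_pos_root big_ord0 expr0 invr1 !mulr1.
apply: (@mulIf _ (lam k ^+ cycle_pos s i)); first by rewrite expf_neq0.
rewrite -!mulrA mulVf ?expf_neq0// mulr1 -exprS lE (eq_porbit ik) lamX.
rewrite -(eq_porbit ik) big_porbit -lE big_ord_recl/=; congr (_ * _).
Qed.

Let WV : W *m V = 1%:M.
Proof.
apply/matrixP => k k'; rewrite !mxE.
have [kk'|kk'] := boolP (k \in porbit s k'); last first.
  rewrite big1 => [|j _]; last first.
    rewrite !mxE; case: ifP => jk; last by rewrite mul0r.
    case: ifP => jk'; last by rewrite mulr0.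
    by move: kk'; rewrite -eq_porbit_mem -(eq_porbit jk) (eq_porbit jk') eqxx.
  case: eqP => // e; by move: kk'; rewrite e porbit_id.
set l := #|porbit s k'|.
have l0 : l%:R != 0 :> F by rewrite pnatr_eq0 card_porbit_neq0.
transitivity (l%:R^-1 * \sum_(a < l) (lam k / lam k') ^+ a).
  rewrite mulr_sumr /l.
  transitivity (\sum_(j in porbit s k')
      l%:R^-1 * (lam k / lam k') ^+ cycle_pos s j).
    rewrite [RHS]big_mkcond/=; apply: eq_bigr => j _.
    rewrite !mxE (eq_porbit kk'); case: ifP => _; last by rewrite mul0r.
    rewrite -/l expr_div_n; have := u_neq0 j; set w := u j => w0.
    rewrite -!mulrA; congr (_ * (_ * _)); rewrite mulrA mulVf ?mul1r//.
  rewrite big_porbit; apply: eq_bigr => a _; by rewrite cycle_pos_iter.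
case: eqP => [->|/eqP kNk'].
  rewrite divff//; under eq_bigr do rewrite expr1n.
  by rewrite sumr_const card_ord mulVf.
(* Distinct eigenvalues of one cycle have a ratio [q] with [q ^+ l = 1] and
   [q != 1], so that the geometric sum of [q] vanishes. *)
set q := _ / _; suff -> : \sum_(a < l) q ^+ a = 0 by rewrite mulr0.
have q1 : q - 1 != 0.
  rewrite subr_eq0; apply: contra_neq kNk' => q1; apply: lam_inj => //.
  by apply: (@mulIf _ (lam k')^-1); rewrite ?invr_neq0// divff.
have lamE : lam k ^+ l = lam k' ^+ l.
  by rewrite /l -{1}(eq_porbit kk') !lamX (eq_porbit kk').
apply: (mulfI q1); rewrite -subrX1 mulr0 /q expr_div_n lamE divff ?subrr//.
by rewrite expf_neq0.
Qed.

Lemma char_poly_cycle_mx :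
  char_poly (\matrix_(j, k) (z j *+ (j == s k))) = \prod_k ('X - (lam k)%:P).
Proof.
transitivity (char_poly (diag_mx (\row_k lam k))).
  apply: (char_poly_similar WV); apply/matrixP => j k.
  rewrite mul_mx_diag !mxE (bigD1 (s^-1 j)%g)//= big1 ?addr0 => [|i ij].
    rewrite mxE permKV eqxx.
    have := eigenV (s^-1 j)%g k; rewrite permKV mulr1n => ->.
    by rewrite mulrC !mxE.
  rewrite mxE; case: eqP => [jE|]; last by rewrite mul0r.
  by move: ij; rewrite jE permK eqxx.
rewrite char_poly_trig ?diag_mx_is_trig//.
by apply: eq_bigr => k _; rewrite !mxE eqxx.
Qed.

End CharPoly.

(** * The number of cycles under the Ewens measure *)

Section EwensNormalization.
Variable n : nat.
Implicit Types (s : 'S_n) (j : 'I_n.+1).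

Local Notation extend := (lift_perm (@ord_max n) (@ord_max n)).

Let extendX s i k : (extend s ^+ i)%g (lift ord_max k) = lift ord_max ((s
  ^+ i)%g k).
Proof.
elim: i => [|i IH]; first by rewrite !perm1.
by rewrite !expgSr !permM IH lift_perm_lift.
Qed.

Let extendX_max s i : (extend s ^+ i)%g ord_max = ord_max.
Proof.
by elim: i => [|i IH]; rewrite ?perm1// expgSr permM IH lift_perm_id.
Qed.

Let porbit_extend s k :
  porbit (extend s) (lift ord_max k) = [set lift ord_max i | i in porbit s
    k]%SET.
Proof.
apply/setP => y; apply/porbitP/imsetP => [[i ->]|[_ /porbitP[i ->] ->]].
  by exists ((s ^+ i)%g k); rewrite ?mem_porbit// extendX.
by exists i; rewrite extendX.
Qed.

Let porbit_extend_max s : porbit (extend s) ord_max = [set ord_max]%SET.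
Proof.
apply/setP => y; rewrite inE; apply/porbitP/eqP => [[i ->]|->].
  by rewrite extendX_max.
by exists 0%N; rewrite perm1.
Qed.

Lemma card_porbits_lift_perm s :
  #|porbits (lift_perm ord_max (@ord_max n) s)| = #|porbits s|.+1.
Proof.
pose L (A : {set 'I_n}) : {set 'I_n.+1} := [set lift ord_max i | i in A]%SET.
have -> : porbits (extend s) = ([set ord_max] |: (L @: porbits s))%SET.
  apply/setP => A; rewrite !inE; apply/imsetP/orP => [[y _ ->]|[/eqP ->|]].
  - case: (unliftP ord_max y) => [k ->|->]; last first.
      by left; rewrite porbit_extend_max.
    by right; rewrite porbit_extend; apply/imsetP; exists (porbit s k);
      rewrite ?imset_f.
  - by exists ord_max; rewrite ?porbit_extend_max.
  - move=> /imsetP[_ /imsetP[k _ ->] ->].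
    by exists (lift ord_max k); rewrite ?porbit_extend.
rewrite cardsU1 (card_imset _ (imset_inj (@lift_inj _ _))).
suff -> : ([set ord_max] \notin L @: porbits s)%SET by [].
apply/imsetP => -[_ /imsetP[k _ ->]] /setP/(_ (lift ord_max k)).
rewrite inE imset_f ?porbit_id//.
by rewrite eq_sym (negPf (neq_lift _ _)).
Qed.

(** Every permutation of n.+1 points arises once as such a product, which
    inserts the last point just after the point [j] of a cycle of [s], or
    makes it a new cycle if [j] is itself the last point. *)
Lemma card_porbits_tperm_lift_perm s j :
  #|porbits (tperm ord_max j * lift_perm ord_max (@ord_max n) s)%g|
    = (#|porbits s| + (j == ord_max))%N.
Proof.
have := porbits_mul_tperm (lift_perm ord_max (@ord_max n) s) ord_max j.
rewrite /= card_porbits_lift_perm porbit_sym porbit_extend_max inE eq_sym.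
by case: eqP => _ /=; rewrite ?addn0 ?addn1// addn2 => -[].
Qed.

Lemma sum_perm_porbits (R : nmodType) (F : nat -> R) :
  \sum_(t : 'S_n.+1) F #|porbits t| =
  \sum_(s : 'S_n) (F #|porbits s|.+1 + F #|porbits s| *+ n).
Proof.
pose f (p : 'I_n.+1 * 'S_n) := (tperm ord_max p.1 * extend p.2)%g.
have f_inj : injective f.
  move=> [j s] [j' s'] /= e.
  have fj k (r : 'S_n) : f (k, r) k = ord_max.
    by rewrite /f/= permM tpermR lift_perm_id.
  have jj' : j = j' by apply: (@perm_inj _ (f (j, s))); rewrite fj e fj.
  subst j'; congr (_, _); move/mulgI : e => /permP e.
  apply/permP => k; have := e (lift ord_max k).
  by rewrite !lift_perm_lift => /lift_inj.
have f_bij : bijective f.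
  by apply: inj_card_bij => //; rewrite card_prod !card_Sn card_ord factS.
rewrite (reindex f); last exact: onW_bij.
rewrite (eq_bigl xpredT)//.
rewrite -(pair_bigA _ (fun j s => F #|porbits (f (j, s))|))/= exchange_big/=.
apply: eq_bigr => s _; rewrite big_ord_recr/= addrC.
rewrite /f/= card_porbits_tperm_lift_perm eqxx addn1; congr (_ + _).
transitivity (\sum_(j < n) F #|porbits s|); last by rewrite sumr_const card_ord.
apply: eq_bigr => j _.
by rewrite card_porbits_tperm_lift_perm -val_eqE/= ltn_eqF ?addn0.
Qed.

End EwensNormalization.

Lemma sum_exp_porbits (R : comPzRingType) (x : R) n :
  \sum_(s : 'S_n) x ^+ #|porbits s| = \prod_(i < n) (x + i%:R).
Proof.
elim: n => [|n IH].
  rewrite big_ord0 (eq_bigr (fun=> 1)).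
    by rewrite sumr_const card_Sn.
  move=> s _; suff -> : porbits s = finset.set0 by rewrite cards0.
  by apply/setP => A; rewrite !inE; apply/imsetP => -[[]].
rewrite (sum_perm_porbits n (fun k => x ^+ k)) big_ord_recr/= -IH mulr_suml.
apply: eq_bigr => s _.
by rewrite exprS mulrDr mulr_natr mulrC.
Qed.

Section EwensCycles.
Variables (R : realType) (theta : R).
Hypothesis theta_gt0 : 0 < theta.

Lemma ewens_ge0 N (s : 'S_N) : 0 <= ewens theta s.
Proof.
have x0 k : 0 <= theta ^+ k by rewrite exprn_ge0// ltW.
by apply: divr_ge0 => //; apply: sumr_ge0.
Qed.

Lemma ewens_exp2_porbits N :
  \sum_(s : 'S_N) ewens theta s * 2 ^+ #|porbits s| =
  \prod_(i < N) ((2 * theta + i%:R) / (theta + i%:R)).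
Proof.
rewrite prodf_div -!sum_exp_porbits mulr_suml; apply: eq_bigr => s _.
by rewrite /ewens mulrAC -exprMn [theta * 2]mulrC.
Qed.

(** The factors of the product in [ewens_exp2_porbits] tend to 1, so from some
    index [n0] on they are below [rho]; as they are all at least 1, the
    product up to [n0] is a valid constant. *)
Lemma ewens_exp2_porbits_le rho : 1 < rho ->
  exists2 C, 0 < C & forall N,
    \sum_(s : 'S_N) ewens theta s * 2 ^+ #|porbits s| <= C * rho ^+ N.
Proof.
move=> rho1; pose a (i : nat) := (2 * theta + i%:R) / (theta + i%:R).
pose n0 := `|Num.ceil (theta / (rho - 1))|%N.
have ti i : 0 < theta + i%:R by rewrite ltr_wpDr.
have a1 i : 1 <= a i.
  by rewrite ler_pdivlMr// mul1r lerD2r mulr_natl mulr2n lerDl ltW.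
have an i : (n0 <= i)%N -> a i <= rho.
  move=> ni; rewrite ler_pdivrMr//.
  have r1 : 0 < rho - 1 by rewrite subr_gt0.
  have : theta <= (rho - 1) * i%:R.
    rewrite mulrC -ler_pdivrMr//.
    apply: (@le_trans _ _ n0%:R); last by rewrite ler_nat.
    apply: (le_trans (ceil_ge _)).
    by rewrite /n0 natr_absz ler_int ler_norm.
  have : 0 <= (rho - 1) * theta by rewrite mulr_ge0 ?ltW.
  lra.
pose g N := \prod_(i < N) a i.
have gS N : g N.+1 = g N * a N by rewrite /g big_ord_recr.
have pos N : 0 < g N by apply: prodr_gt0 => i _; exact: lt_le_trans (a1 i).
exists (g n0) => // N; rewrite ewens_exp2_porbits -/(g N).
have rN k : 1 <= rho ^+ k by rewrite exprn_ege1// ltW.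
have [le|/ltnW le] := leqP N n0.
  apply: (@le_trans _ _ (g n0)); last by rewrite ler_peMr// ltW.
  rewrite -(subnKC le); elim: (n0 - N)%N => [|k IH]; first by rewrite addn0.
  by rewrite addnS gS (le_trans IH)// ler_peMr// ltW.
apply: (@le_trans _ _ (g n0 * rho ^+ (N - n0))).
  rewrite -{1}(subnKC le); elim: (N - n0)%N => [|k IH].
    by rewrite addn0 expr0 mulr1.
  rewrite addnS gS exprSr [leRHS]mulrA.
  apply: (ler_pM (ltW (pos _)) (le_trans ler01 (a1 _)) IH).
  by rewrite an// leq_addr.
rewrite ler_pM2l//; apply: ler_weXn2l; first exact/ltW.
exact: leq_subr.
Qed.

End EwensCycles.

(** * Measure-theoretic tools *)

Lemma measurable_ler_set d (T : measurableType d) (R : realType)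
    (f g : T -> R) :
  measurable_fun setT f -> measurable_fun setT g ->
  measurable [set w | f w <= g w].
Proof.
move=> mf mg; rewrite -[X in measurable X]setTI.
have /(_ measurableT [set true]) := measurable_fun_ler mf mg.
by rewrite (_ : _ @^-1` [set true] = [set w | f w <= g w]) => [|//]; exact.
Qed.

Lemma measurable_sum_cond d (T : measurableType d) (R : realType) (I : Type)
    (r : seq I) (Q : pred I) (h : I -> T -> R) :
  (forall i, measurable_fun setT (h i)) ->
  measurable_fun setT (fun w => \sum_(i <- r | Q i) h i w).
Proof.
move=> mh; under eq_fun do rewrite -big_filter.
exact: measurable_sum.
Qed.

Lemma markov_ge0 d (T : measurableType d) (R : realType)
    (P : probability T R) (f : T -> R) (a c : R) : measurable_fun setT f ->
  (forall w, 0 <= f w) -> 0 < c -> (\int[P]_w (f w)%:E <= a%:E)%E ->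
  (P [set w | (c <= f w)%R] <= (a / c)%:E)%E.
Proof.
move=> mf f0 c0 fa.
have mA : measurable [set w | c <= f w].
  exact: measurable_ler_set.
rewrite EFinM muleC lee_pdivlMl//; apply: le_trans fa.
have -> : (c%:E * P [set w | (c <= f w)%R] =
    \int[P]_w (c * \1_[set w | (c <= f w)%R] w)%:E)%E.
  under eq_integral do rewrite EFinM.
  rewrite ge0_integralZl ?lee_fin ?(ltW c0)//.
  - by rewrite integral_indic ?setIT.
  - by apply/measurable_EFinP; exact: measurable_indic.
apply: ge0_le_integral => //.
- by move=> w _; rewrite lee_fin mulr_ge0// ltW.
- by apply/measurable_EFinP; apply: measurable_funM => //;
  exact: measurable_indic.
- exact/measurable_EFinP.
- move=> w _; rewrite lee_fin indicE; case: (boolP (w \in _)) => /=.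
    by rewrite inE/= mulr1.
  by rewrite mulr0.
Qed.

Lemma prob_le_sum d (T : measurableType d) (R : realType)
    (P : probability T R) (I : finType) (A : set T) (B : I -> set T) :
  measurable A -> (forall i, measurable (B i)) -> A `<=` \bigcup_i B i ->
  (P A <= \sum_i P (B i))%E.
Proof.
move=> mA mB AB.
have ind C : measurable C -> P C = (\int[P]_w (\1_C w)%:E)%E.
  by move=> mC; rewrite integral_indic// setIT.
rewrite ind//; under eq_bigr do rewrite ind//.
rewrite -ge0_integral_sum//; last first.
  by move=> i; apply/measurable_EFinP; exact: measurable_indic.
apply: ge0_le_integral => //.
- by apply/measurable_EFinP; exact: measurable_indic.
- by apply: emeasurable_sum => i; apply/measurable_EFinP;
  exact: measurable_indic.
- move=> w _; rewrite sumEFin lee_fin indicE; case: (boolP (w \in A)) => /=.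
    rewrite inE => /AB[i _ Bi]; rewrite (bigD1 i)//= indicE mem_set// lerDl.
    exact: sumr_ge0.
  by move=> _; exact: sumr_ge0.
Qed.

Lemma borel_cantelli_ae d (T : measurableType d) (R : realType)
    (P : probability T R) (F : nat -> set T) (c : R) :
  (forall k, measurable (F k)) ->
  (forall K, \sum_(k < K) P (F k) <= c%:E)%E ->
  {ae P, forall w, exists n0, forall n, (n0 <= n)%N -> ~ F n w}.
Proof.
move=> mF Fc.
have F0 : P (lim_sup_set F) = 0%E.
  apply: lim_sup_set_cvg0 => //; apply: (@le_lt_trans _ _ c%:E);
    last exact: ltry.
  apply: lime_le; first exact: is_cvg_nneseries.
  by apply: nearW => K; rewrite big_mkord.
exists (lim_sup_set F); split => //.
  by apply: bigcap_measurable => // n _; exact: bigcup_measurable.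
move=> w /= /forallNP H n _.
have /existsNP[m /not_implyP[nm /contrapT Fm]] := H n.
by exists m.
Qed.

Lemma integral_of_law d d' (T : measurableType d) (E : measurableType d')
    (R : realType) (P : probability T R) (L : probability E R)
    (Z : {RV P >-> E}) (h : E -> R) :
  (forall A, measurable A -> distribution P Z A = L A) ->
  measurable_fun setT h -> P.-integrable setT (fun w => (h (Z w))%:E) ->
  L.-integrable setT (EFin \o h) /\
  (\int[L]_x (h x)%:E = \int[P]_w (h (Z w))%:E)%E.
Proof.
move=> ZL mh ih.
have eqL (f : E -> \bar R) : (\int[L]_x f x = \int[distribution P Z]_x f x)%E.
  by apply: eq_measure_integral => A mA _; exact/esym/ZL.
split.
  apply/integrableP; split; first exact/measurable_EFinP.
  rewrite eqL ge0_integral_distribution//; last first.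
    by apply: measurableT_comp => //; exact/measurable_EFinP.
  by move/integrableP : ih => [].
rewrite eqL; apply: (etrans (integral_distribution (X := Z) _ ih)) => //.
exact/measurable_EFinP.
Qed.

(** * Products of functions of independent variables *)

Section Independence.
Context d (T : measurableType d) (R : realType) (P : probability T R).
Context d' (E : measurableType d').

(** Knowing the factorization on indicators is enough: both sides are linear
    in [g] and continuous along nondecreasing sequences. *)
Lemma integral_mul_comp (X : {RV P >-> E}) (H : T -> R) (c : R) :
  measurable_fun setT H -> (forall w, 0 <= H w) -> 0 <= c ->
  (forall B, measurable B ->
    \int[P]_w (H w * \1_B (X w))%:E = c%:E * P (X @^-1` B))%E ->
  forall g : E -> R, measurable_fun setT g -> (forall x, 0 <= g x) ->
  (\int[P]_w (H w * g (X w))%:E = c%:E * \int[P]_w (g (X w))%:E)%E.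
Proof.
move=> mH H0 c0 HB g mg g0.
have mX : measurable_fun setT X by [].
have mind (B : set E) : measurable B ->
    measurable_fun setT (fun w => \1_B (X w) : R).
  by move=> mB; apply: (measurableT_comp _ mX); exact: measurable_indic.
have sfun (f : {nnsfun E >-> R}) :
    (\int[P]_w (H w * f (X w))%:E = c%:E * \int[P]_w (f (X w))%:E)%E.
  have mfy (y : R) : measurable (f @^-1` [set y]) by [].
  have my (y : R) : measurable_fun setT (fun w => (y * (\1_(f @^-1` [set y])
    (X w)))%:E).
    by apply/measurable_EFinP; apply: measurable_funM => //; exact: mind.
  have mHy (y : R) :
      measurable_fun setT (fun w => (y * (H w * \1_(f @^-1` [set y]) (X
        w)))%:E).
    apply/measurable_EFinP; apply: measurable_funM => //.
    by apply: measurable_funM => //; exact: mind.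
  have y0 (y : R) (x : E) : 0 <= y * \1_(f @^-1` [set y]) x.
    rewrite indicE; case: (boolP (x \in _)) => [|_]; last by rewrite mulr0.
    by rewrite inE/= => <-; rewrite mulr1.
  have -> : (\int[P]_w (f (X w))%:E =
      \sum_(y \in range f) y%:E * P (X @^-1` (f @^-1` [set y])))%E.
    under eq_integral do rewrite fimfunE -fsumEFin//.
    rewrite ge0_integral_fsum//; last by move=> y w _; rewrite lee_fin.
    apply: eq_fsbigr => y; rewrite inE => -[x _ fxy].
    have y_ge0 : 0 <= y by rewrite -fxy.
    under eq_integral do rewrite EFinM.
    rewrite ge0_integralZl//; last by apply/measurable_EFinP; exact: mind.
    congr (_ * _)%E; rewrite (_ : (fun w => _) = EFin \o \1_(X @^-1` (f
      @^-1` [set y])))//.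
    rewrite integral_indic ?setIT//.
    by rewrite -[X in measurable X]setTI; exact: mX.
  rewrite ge0_mule_fsumr; last first.
    move=> y; have [y_ge0|y_lt0] := leP 0 y; first by rewrite mule_ge0.
    rewrite (_ : f @^-1` [set y] = set0) ?preimage_set0 ?measure0 ?mule0//.
    by apply/seteqP; split => // x /= fxy; move: y_lt0;
      rewrite -fxy ltNge fun_ge0.
  transitivity (\int[P]_w (\sum_(y \in range f)
      (y * (H w * \1_(f @^-1` [set y]) (X w)))%:E))%E.
    apply: eq_integral => w _; rewrite fsumEFin// fimfunE; congr EFin.
    rewrite mulr_fsumr//; apply: eq_fsbigr => y _; ring.
  rewrite ge0_integral_fsum//; last first.
    by move=> y w _; rewrite lee_fin mulrCA mulr_ge0.
  apply: eq_fsbigr => y; rewrite inE => -[x _ fxy].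
  have y_ge0 : 0 <= y by rewrite -fxy.
  under eq_integral do rewrite EFinM.
  rewrite ge0_integralZl//.
  - by rewrite HB// muleCA.
  - by apply/measurable_EFinP; apply: measurable_funM => //; exact: mind.
  - by move=> w _; rewrite lee_fin mulr_ge0.
have mg' : measurable_fun setT (EFin \o g) by exact/measurable_EFinP.
pose f n := nnsfun_approx measurableT mg' n.
have cvgf x : (f n x)%:E @[n --> \oo] --> (g x)%:E.
  by apply: (cvg_nnsfun_approx measurableT mg') => // y _; rewrite lee_fin.
have ndf x : nondecreasing_seq (f ^~ x).
  by move=> m n mn; apply/lefP : x; exact: (nd_nnsfun_approx measurableT mg').
have mfX n : measurable_fun setT (fun w => f n (X w)).
  exact: measurableT_comp.
have lhs : (\int[P]_w (H w * f n (X w))%:E @[n --> \oo] -->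
            \int[P]_w (H w * g (X w))%:E)%E.
  rewrite [X in _ --> X](_ : _ =
      \int[P]_w (limn (fun n => (H w * f n (X w))%:E)))%E; last first.
    apply: eq_integral => w _; apply/esym/cvg_lim => //.
    under eq_fun do rewrite EFinM; rewrite EFinM; apply: cvgeZl => //.
  apply: cvg_monotone_convergence => //.
  - move=> n; apply/measurable_EFinP; exact: measurable_funM.
  - by move=> n w _; rewrite lee_fin mulr_ge0.
  - by move=> w _ m n mn; rewrite lee_fin ler_wpM2l// ndf.
have rhs : (c%:E * \int[P]_w (f n (X w))%:E @[n --> \oo] -->
            c%:E * \int[P]_w (g (X w))%:E)%E.
  apply: cvgeZl => //.
  rewrite [X in _ --> X](_ : _ =
      \int[P]_w (limn (fun n => (f n (X w))%:E)))%E; last first.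
    apply: eq_integral => w _; apply/esym/cvg_lim => //; exact: cvgf.
  apply: cvg_monotone_convergence => //.
  - by move=> n; exact/measurable_EFinP.
  - by move=> n w _; rewrite lee_fin.
  - by move=> w _ m n mn; rewrite lee_fin ndf.
have e : (fun n => \int[P]_w (H w * f n (X w))%:E)%E =
         (fun n => c%:E * \int[P]_w (f n (X w))%:E)%E.
  by apply/funext => n; exact: sfun.
by move: lhs; rewrite e => lhs; exact: (cvg_unique _ lhs rhs).
Qed.

Context (I : choiceType) (z : I -> {RV P >-> E}).
Hypothesis z_indep : mutually_independent P
  (fun j => preimage_set_system setT (z j) measurable).

Lemma prob_bigcap_indep (J : seq I) (B : I -> set E) : uniq J ->
  (forall j, measurable (B j)) ->
  P (\bigcap_(j in [set` J]) (z j @^-1` B j)) =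
    (\prod_(j <- J) P (z j @^-1` B j))%E.
Proof.
move=> uJ mB.
have := z_indep (J := [fset x in J]%fset) (E := fun j => z j @^-1` B j).
have -> : [set` [fset x in J]%fset] = [set` J].
  by apply/seteqP; split=> x /=; rewrite !inE.
move=> -> => [|j _]; last by exists (B j) => //; rewrite setTI.
by apply: perm_big; apply: uniq_perm => // x; rewrite !inE.
Qed.

(** The functions in [J2] are still indicators, those in [J1] are arbitrary;
    each step of the induction frees one function by [integral_mul_comp], and
    the case where all are indicators is the definition of independence. *)
Lemma integral_prod_indep_aux (J1 J2 : seq I) (g : I -> E -> R) (c : I -> R) :
  uniq (J1 ++ J2) ->
  (forall j, measurable_fun setT (g j)) -> (forall j x, 0 <= g j x) ->
  (forall j, \int[P]_w (g j (z j w))%:E = (c j)%:E)%E ->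
  (forall j, j \in J2 -> exists2 B, measurable B & g j = \1_B) ->
  (\int[P]_w (\prod_(j <- J1 ++ J2) g j (z j w))%:E
    = (\prod_(j <- J1 ++ J2) c j)%:E)%E.
Proof.
elim: J1 J2 g c => [|j0 J1 IH] J2 g c.
  move=> /= uJ mg g0 gc ind.
  have mz j (B : set E) : measurable B -> measurable (z j @^-1` B).
    by move=> mB; rewrite -[X in measurable X]setTI; exact: measurable_funP.
  pose B j := if j \in J2 then [set x | g j x = 1] else setT.
  have mB j : measurable (B j).
    rewrite /B; case: ifP => // _; rewrite -[X in measurable X]setTI.
    exact: (mg j measurableT _ (measurable_set1 1)).
  have gB j : j \in J2 -> g j = \1_(B j).
    move=> jJ; rewrite /B jJ; have [C mC ->] := ind _ jJ.
    apply/funext => x; rewrite !indicE; congr ((_ : bool)%:R).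
    apply/idP/idP => [xC|]; first by rewrite inE/= indicE xC.
    by rewrite inE/= indicE; case: (x \in C) => //= /esym/eqP; rewrite oner_eq0.
  have cB j : j \in J2 -> (c j)%:E = P (z j @^-1` B j).
    move=> jJ; rewrite -gc gB// (_ : (fun w => _) = EFin \o \1_(z j @^-1` B
      j))//.
    by rewrite integral_indic ?setIT//; exact: mz.
  transitivity (\int[P]_w (\1_(\bigcap_(j in [set` J2]) (z j @^-1` B j))
    w)%:E)%E.
    apply: eq_integral => w _; congr EFin; rewrite indicE.
    have [wB|wB] := boolP (w \in _).
      move: wB; rewrite inE => wB; rewrite big_seq big1 // => j jJ.
      by rewrite gB// indicE mem_set//; exact: wB.
    have : ~ (\bigcap_(j in [set` J2]) (z j @^-1` B j)) w by move: wB;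
      rewrite notin_setE.
    move=> /existsNP[j /not_implyP[/= jJ jB]].
    by rewrite (big_rem j)//= gB// indicE memNset// mul0r.
  rewrite integral_indic ?setIT//; last first.
    rewrite bigcap_seq; apply: bigsetI_measurable => j _; exact: mz.
  apply: (etrans (prob_bigcap_indep uJ mB)).
  rewrite -prodEFin [LHS]big_seq [RHS]big_seq; apply: eq_bigr => j jJ.
  by rewrite cB.
move=> /= /andP[j0J uJ] mg g0 gc ind.
have c0 j : 0 <= c j by rewrite -lee_fin -gc integral_ge0// => w _;
  rewrite lee_fin.
rewrite big_cons.
under eq_integral do rewrite big_cons mulrC.
rewrite (@integral_mul_comp _ _ (\prod_(j <- J1 ++ J2) c j))//.
- by rewrite gc -EFinM mulrC.
- by apply: measurable_prod => j _; exact: measurableT_comp.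
- by move=> w; apply: prodr_ge0.
- exact: prodr_ge0.
move=> B mB.
(* The function at [j0] is replaced by the indicator of [B]. *)
pose g' j := if j == j0 then \1_B else g j.
pose c' j := if j == j0 then fine (P (z j0 @^-1` B)) else c j.
have := IH (j0 :: J2) g' c'.
have neq j : j \in J1 ++ J2 -> (j == j0) = false.
  by move=> jJ; apply: contraNF j0J => /eqP <-.
have perm_j0 : perm_eq (J1 ++ j0 :: J2) (j0 :: J1 ++ J2) by rewrite
  perm_catC/= perm_cons perm_catC.
have gE w : \prod_(j <- J1 ++ j0 :: J2) g' j (z j w) =
    \prod_(j <- J1 ++ J2) g j (z j w) * \1_B (z j0 w).
  rewrite (perm_big _ perm_j0)/= big_cons mulrC /g' eqxx; congr (_ * _).
  by rewrite big_seq [RHS]big_seq; apply: eq_bigr => j jJ; rewrite neq.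
have cE : \prod_(j <- J1 ++ j0 :: J2) c' j =
    \prod_(j <- J1 ++ J2) c j * fine (P (z j0 @^-1` B)).
  rewrite (perm_big _ perm_j0)/= big_cons mulrC /c' eqxx; congr (_ * _).
  by rewrite big_seq [RHS]big_seq; apply: eq_bigr => j jJ; rewrite neq.
under eq_integral do rewrite gE.
rewrite cE.
have mz : measurable (z j0 @^-1` B).
  by rewrite -[X in measurable X]setTI; exact: measurable_funP.
move=> ->.
- by rewrite EFinM fineK// fin_num_measure.
- by rewrite (perm_uniq perm_j0)/= j0J.
- by move=> j; rewrite /g'; case: eqP => // _; exact: measurable_indic.
- by move=> j x; rewrite /g'; case: eqP => // _; rewrite indicE.
- move=> j; rewrite /g' /c'; case: eqP => // ->.
  rewrite fineK ?fin_num_measure// (_ : (fun w => _) = EFin \o \1_(z j0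
    @^-1` B))//.
  by rewrite integral_indic ?setIT.
- move=> j; rewrite inE /g'; case: eqP => [->|_] /=; first by exists B.
  exact: ind.
Qed.

Lemma integral_prod_indep (J : seq I) (g : I -> E -> R) (c : I -> R) :
  uniq J ->
  (forall j, measurable_fun setT (g j)) -> (forall j x, 0 <= g j x) ->
  (forall j, \int[P]_w (g j (z j w))%:E = (c j)%:E)%E ->
  (\int[P]_w (\prod_(j <- J) g j (z j w))%:E = (\prod_(j <- J) c j)%:E)%E.
Proof.
move=> uJ mg g0 gc.
by have := @integral_prod_indep_aux J [::] g c; rewrite cats0; exact.
Qed.

End Independence.

(** * A one-sided law of large numbers *)

Section Iid.
Context d (T : measurableType d) (R : realType) (P : probability T R).
Context d' (E : measurableType d') (L : probability E R).
Context (z : nat -> {RV P >-> E}).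
Hypothesis z_law : forall j A, measurable A -> distribution P (z j) A = L A.
Hypothesis z_indep : mutually_independent P
  (fun j => preimage_set_system setT (z j) measurable).

Lemma integral_law j (g : E -> R) : measurable_fun setT g ->
  (forall x, 0 <= g x) ->
  (\int[P]_w (g (z j w))%:E = \int[L]_x (g x)%:E)%E.
Proof.
move=> mg g0; rewrite -(@eq_measure_integral _ _ _ _ L (distribution P (z j))).
  by rewrite ge0_integral_distribution//; exact/measurable_EFinP.
by move=> A mA _; exact: z_law.
Qed.

Let mcomp (g : E -> R) j :
  measurable_fun setT g -> measurable_fun setT (fun w => g (z j w)).
Proof. by move=> mg; exact: measurableT_comp. Qed.

Lemma integral_pair_indep (v : E -> R) (b q : R) i j :
  measurable_fun setT v -> (forall x, 0 <= v x) ->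
  (\int[L]_x (v x)%:E = b%:E)%E -> (\int[L]_x (v x ^+ 2)%:E = q%:E)%E ->
  (\int[P]_w (v (z i w) * v (z j w))%:E <= ((i == j)%:R * q + b ^+ 2)%:E)%E.
Proof.
move=> mv v0 vb vq; have [<-|ij] := eqVneq i j.
  have mv2 : measurable_fun setT (fun x => v x ^+ 2) by exact: measurable_funX.
  under eq_integral do rewrite -expr2.
  rewrite (integral_law i mv2) => [|x]; last by rewrite sqr_ge0.
  by rewrite vq lee_fin mul1r lerDl sqr_ge0.
rewrite mul0r add0r.
have e w : v (z i w) * v (z j w) = \prod_(k <- [:: i; j]) v (z k w).
  by rewrite !big_cons big_nil mulr1.
under eq_integral do rewrite e.
rewrite (integral_prod_indep z_indep (g := fun=> v) (c := fun=> b))//.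
- by rewrite !big_cons big_nil mulr1.
- by rewrite /= inE ij.
- by move=> k; rewrite integral_law.
Qed.

(** The variance of a sum of independent variables is the sum of their
    variances. The computation is kept within integrals of nonnegative
    functions by adding [2 n b S] to both sides of the expansion of
    [(S - n b) ^ 2]. *)
Lemma integral_sqr_sum_indep (v : E -> R) (b q : R) n :
  measurable_fun setT v -> (forall x, 0 <= v x) ->
  (\int[L]_x (v x)%:E = b%:E)%E -> (\int[L]_x (v x ^+ 2)%:E = q%:E)%E ->
  (\int[P]_w ((\sum_(j < n) v (z j w) - n%:R * b) ^+ 2)%:E <= (n%:R * q)%:E)%E.
Proof.
move=> mv v0 vb vq.
have b0 : 0 <= b by rewrite -lee_fin -vb integral_ge0// => x _; rewrite lee_fin.
pose S w := \sum_(j < n) v (z j w).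
have mS : measurable_fun setT S by apply: measurable_sum => j; exact: mcomp.
have S0 w : 0 <= S w by exact: sumr_ge0.
have ES : (\int[P]_w (S w)%:E = (n%:R * b)%:E)%E.
  under eq_integral do rewrite /S -sumEFin.
  rewrite ge0_integral_sum//.
  - under eq_bigr do rewrite integral_law// vb.
    by rewrite sumEFin sumr_const card_ord mulr_natl.
  - by move=> j; apply/measurable_EFinP; exact: mcomp.
  - by move=> j w _; rewrite lee_fin.
have ES2 : (\int[P]_w (S w ^+ 2)%:E <= (n%:R * q + (n%:R * b) ^+ 2)%:E)%E.
  have mij (i j : 'I_n) : measurable_fun setT (fun w => (v (z i w) * v (z j
    w))%:E).
    by apply/measurable_EFinP; apply: measurable_funM; exact: mcomp.
  have vij (i j : 'I_n) w : (0 <= (v (z i w) * v (z j w))%:E)%E.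
    by rewrite lee_fin mulr_ge0.
  have -> : (\int[P]_w (S w ^+ 2)%:E =
      \sum_(i < n) \sum_(j < n) \int[P]_w (v (z i w) * v (z j w))%:E)%E.
    transitivity (\int[P]_w (\sum_(i < n) \sum_(j < n) (v (z i w) * v (z j
      w))%:E))%E.
      apply: eq_integral => w _; rewrite expr2 /S mulr_suml -sumEFin.
      by apply: eq_bigr => i _; rewrite mulr_sumr -sumEFin.
    rewrite ge0_integral_sum//.
    - by apply: eq_bigr => i _; rewrite ge0_integral_sum.
    - by move=> i; apply: emeasurable_sum.
    - by move=> i w _; apply: sume_ge0.
  have -> : (n%:R * q + (n%:R * b) ^+ 2)%:E =
      (\sum_(i < n) \sum_(j < n) (((i : nat) == j)%:R * q + b ^+ 2)%:E)%E.
    transitivity (\sum_(i < n) (q + n%:R * b ^+ 2)%:E)%E.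
      rewrite sumEFin sumr_const card_ord -mulr_natl; congr EFin; ring.
    apply: eq_bigr => i _; rewrite sumEFin; congr EFin.
    rewrite big_split/= sumr_const card_ord mulr_natl; congr (_ + _).
    rewrite -mulr_suml (bigD1 i)//= eqxx big1 ?addr0 ?mul1r// => j.
    by rewrite -val_eqE/= eq_sym => /negPf ->.
  by apply: lee_sum => i _; apply: lee_sum => j _; exact: integral_pair_indep.
have nb0 : 0 <= n%:R * b by rewrite mulr_ge0.
have m1 : measurable_fun setT (fun w => ((S w - n%:R * b) ^+ 2)%:E).
  by apply/measurable_EFinP; apply: measurable_funX; exact: measurable_funB.
have m2 : measurable_fun setT (fun w => ((2 * (n%:R * b)) * S w)%:E).
  by apply/measurable_EFinP; exact: measurable_funM.
have m3 : measurable_fun setT (fun w => (S w ^+ 2)%:E).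
  by apply/measurable_EFinP; exact: measurable_funX.
have key : (\int[P]_w ((S w - n%:R * b) ^+ 2)%:E + (2 * (n%:R * b) ^+ 2)%:E
    = \int[P]_w (S w ^+ 2)%:E + ((n%:R * b) ^+ 2)%:E)%E.
  have -> : ((2 * (n%:R * b) ^+ 2)%:E =
      \int[P]_w ((2 * (n%:R * b)) * S w)%:E)%E.
    under eq_integral do rewrite EFinM.
    rewrite ge0_integralZl//.
    - by rewrite ES -EFinM; congr EFin; ring.
    - exact/measurable_EFinP.
    - by move=> w _; rewrite lee_fin.
    - by rewrite lee_fin mulr_ge0.
  have -> : (((n%:R * b) ^+ 2)%:E = \int[P]_w ((n%:R * b) ^+ 2)%:E)%E.
    by rewrite integral_cst//= probability_setT mule1.
  rewrite -!ge0_integralD//.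
  - by apply: eq_integral => w _; rewrite -!EFinD; congr EFin; ring.
  - by move=> w _; rewrite lee_fin sqr_ge0.
  - by move=> w _; rewrite lee_fin sqr_ge0.
  - by move=> w _; rewrite lee_fin sqr_ge0.
  - by move=> w _; rewrite lee_fin !mulr_ge0.
rewrite -/(S _) -(@leeD2rE _ (2 * (n%:R * b) ^+ 2)%:E)//.
rewrite key; apply: (le_trans (leeD2r _ ES2)).
rewrite -!EFinD lee_fin; lra.
Qed.

End Iid.

(** Summability of the second moments of the truncations at the powers of 2:
    the terms with [2 ^ k <= W] equal [2 ^ k] and sum to at most [2 * W], the
    others form a geometric series of ratio 1/2 starting below [W]. *)
Lemma sum_dyadic_truncation_le (R : realType) (W : R) K : 0 <= W ->
  \sum_(k < K) Num.min W (2 ^+ k) ^+ 2 / 2 ^+ k <= 4 * W.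
Proof.
move=> W0; set S := fun K => \sum_(k < K) Num.min W (2 ^+ k) ^+ 2 / 2 ^+ k.
have p0 k : 0 < 2 ^+ k :> R by rewrite exprn_gt0.
(* The two bounds are the invariants of an induction on the number of terms,
   before and after the powers of 2 exceed [W]. *)
have hi k : 2 ^+ k <= W -> S k <= 2 ^+ k.
  elim: k => [|k IH] le; first by rewrite /S big_ord0.
  have le' : 2 ^+ k <= W by move: le; rewrite exprS; have := p0 k; lra.
  rewrite /S big_ord_recr/= -/(S k) min_r// expr2 mulfK ?gt_eqF//.
  by rewrite exprS mulr_natl mulr2n lerD2r IH.
have lo k : W <= 2 ^+ k -> S k <= 4 * W - 2 * (W ^+ 2 / 2 ^+ k).
  elim: k => [|k IH] le.
    by rewrite /S big_ord0 expr0 divr1 in le *; nra.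
  rewrite /S big_ord_recr/= -/(S k) (exprS 2 k) invfM.
  have [Wk|/ltW Wk] := leP W (2 ^+ k).
    have := IH Wk.
    set q := W ^+ 2 / _; lra.
  rewrite expr2 mulfK ?gt_eqF//; have := hi k Wk.
  have -> : 2 * (W ^+ 2 * (2^-1 * (2 ^+ k)^-1)) = W ^+ 2 / 2 ^+ k by field;
    rewrite gt_eqF.
  move=> Sk.
  have : W ^+ 2 / 2 ^+ k <= 4 * W - 2 * 2 ^+ k.
    rewrite ler_pdivrMr//; move: le; rewrite exprS; have := p0 k;
      set t := 2 ^+ k in Wk *.
    move=> t0 le; have : 0 <= (W - t) * (2 * t - W) by apply: mulr_ge0; lra.
    nra.
  lra.
have [le|/ltW le] := leP W (2 ^+ K).
  by apply: (le_trans (lo K le)); rewrite gerBl mulr_ge0// mulr_ge0 ?sqr_ge0//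
    invr_ge0 ltW.
by apply: (le_trans (hi K le)); lra.
Qed.

Section IidBound.
Context d (T : measurableType d) (R : realType) (P : probability T R).
Context d' (E : measurableType d') (L : probability E R).
Context (z : nat -> {RV P >-> E}).
Hypothesis z_law : forall j A, measurable A -> distribution P (z j) A = L A.
Hypothesis z_indep : mutually_independent P
  (fun j => preimage_set_system setT (z j) measurable).

Variables (h : E -> R) (a delta : R).
Hypothesis mh : measurable_fun setT h.
Hypothesis h0 : forall x, 0 <= h x.
Hypothesis ha : (\int[L]_x (h x)%:E = a%:E)%E.
Hypothesis delta_gt0 : 0 < delta.

Let p0 k : 0 < 2 ^+ k :> R. Proof. by rewrite exprn_gt0. Qed.

(** For sums of 2 ^ k variables, [h] is truncated at 2 ^ k. *)
Let V k x : R := Num.min (h x) (2 ^+ k).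
Let mV k : measurable_fun setT (V k).
Proof. exact: measurable_minr. Qed.
Let V0 k x : 0 <= V k x.
Proof. by rewrite le_min h0 ltW. Qed.

Let u k x := V k x ^+ 2 / 2 ^+ k.
Let mu_ k : measurable_fun setT (u k).
Proof. by apply: measurable_funM => //; exact: measurable_funX. Qed.
Let u0 k x : 0 <= u k x.
Proof. by rewrite mulr_ge0 ?sqr_ge0// invr_ge0 ltW. Qed.

Let sum_u K : (\sum_(k < K) \int[L]_x (u k x)%:E <= (4 * a)%:E)%E.
Proof.
rewrite -ge0_integral_sum//; last 2 first.
- by move=> k; apply/measurable_EFinP.
- by move=> k x _; rewrite lee_fin.
rewrite EFinM -ha -ge0_integralZl//; last 2 first.
- exact/measurable_EFinP.
- by move=> x _; rewrite lee_fin.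
apply: ge0_le_integral => //.
- by move=> x _; apply: sume_ge0 => k _; rewrite lee_fin.
- by apply: emeasurable_sum => k; apply/measurable_EFinP.
- by apply/measurable_EFinP; exact: measurable_funM.
- by move=> x _; rewrite sumEFin -EFinM lee_fin;
  exact: sum_dyadic_truncation_le.
Qed.

Let q k : R := fine (\int[L]_x (u k x)%:E)%E.

Let qE k : (\int[L]_x (u k x)%:E = (q k)%:E)%E.
Proof.
rewrite fineK// ge0_fin_numE; last by apply: integral_ge0 => x _;
  rewrite lee_fin.
apply: (@le_lt_trans _ _ (4 * a)%:E); last exact: ltry.
apply: le_trans (sum_u k.+1); rewrite big_ord_recr/= leeDr//.
by apply: sume_ge0 => i _; apply: integral_ge0 => x _; rewrite lee_fin.
Qed.

Let S (g : E -> R) n w := \sum_(j < n) g (z j w).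
Let mS g n : measurable_fun setT g -> measurable_fun setT (S g n).
Proof. by move=> mg; apply: measurable_sum => j; exact: measurableT_comp. Qed.

Let bad k := [set w | (2 ^ k)%:R * (a + delta) <= S h (2 ^ k) w].

Let bad_le k : (P (bad k) <= ((1 + delta ^- 2) * q k)%:E)%E.
Proof.
pose n : R := 2 ^+ k; have n0 : 0 < n := p0 k.
have nE : (2 ^ k)%:R = n by rewrite natrX.
pose b : R := fine (\int[L]_x (V k x)%:E)%E.
have Vh : (\int[L]_x (V k x)%:E <= a%:E)%E.
  rewrite -ha; apply: ge0_le_integral => //.
  - by move=> x _; rewrite lee_fin.
  - exact/measurable_EFinP.
  - exact/measurable_EFinP.
  - by move=> x _; rewrite lee_fin ge_min lexx.
have bE : (\int[L]_x (V k x)%:E = b%:E)%E.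
  rewrite fineK// ge0_fin_numE; last by apply: integral_ge0 => x _;
    rewrite lee_fin.
  by apply: le_lt_trans Vh _; exact: ltry.
have ba : b <= a by rewrite -lee_fin -bE.
have mV2 : measurable_fun setT (fun x => V k x ^+ 2) by exact: measurable_funX.
have V2E : (\int[L]_x (V k x ^+ 2)%:E = (n * q k)%:E)%E.
  rewrite EFinM -qE -ge0_integralZl//.
  - apply: eq_integral => x _; rewrite -EFinM /u; congr EFin.
    by rewrite mulrC mulfVK// gt_eqF.
  - exact/measurable_EFinP.
  - by move=> x _; rewrite lee_fin.
  - by rewrite lee_fin ltW.
(* On the bad event either some variable exceeds [n], and then the first term
   is at least 1, or the truncation changes nothing, and then the deviation
   of the truncated sum makes the second term at least 1. A single use of
   Markov's inequality for [f] covers both cases. *)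
pose f w := S (fun x => V k x ^+ 2) (2 ^ k) w / n ^+ 2
          + (S (V k) (2 ^ k) w - n * b) ^+ 2 / (n * delta) ^+ 2.
have mf1 : measurable_fun setT (fun w => S (fun x => V k x ^+ 2) (2 ^ k) w / n
  ^+ 2).
  by apply: measurable_funM => //; exact: mS.
have mf2 : measurable_fun setT (fun w => (S (V k) (2 ^ k) w - n * b) ^+ 2 / (n
  * delta) ^+ 2).
  apply: measurable_funM => //; apply: measurable_funX;
    apply: measurable_funB => //.
  exact: mS.
have f10 w : 0 <= S (fun x => V k x ^+ 2) (2 ^ k) w / n ^+ 2.
  by rewrite mulr_ge0 ?invr_ge0 ?sqr_ge0// sumr_ge0// => j _; rewrite sqr_ge0.
have f20 w : 0 <= (S (V k) (2 ^ k) w - n * b) ^+ 2 / (n * delta) ^+ 2.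
  by rewrite mulr_ge0 ?invr_ge0 ?sqr_ge0.
have mbad : measurable (bad k) by apply: measurable_ler_set => //; exact: mS.
have fE : (\int[P]_w (f w)%:E <= ((1 + delta ^- 2) * q k)%:E)%E.
  under eq_integral do rewrite EFinD.
  rewrite ge0_integralD//; last 4 first.
  - by move=> w _; rewrite lee_fin.
  - exact/measurable_EFinP.
  - by move=> w _; rewrite lee_fin.
  - exact/measurable_EFinP.
  rewrite mulrDl mul1r EFinD; apply: leeD.
    under eq_integral do rewrite mulrC EFinM.
    rewrite ge0_integralZl//; last 3 first.
    - by apply/measurable_EFinP; exact: mS.
    - by move=> w _; rewrite lee_fin sumr_ge0// => j _; rewrite sqr_ge0.
    - by rewrite lee_fin invr_ge0 sqr_ge0.
    under eq_integral do rewrite /S -sumEFin.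
    rewrite ge0_integral_sum//; last 2 first.
    - by move=> j; apply/measurable_EFinP; exact: (measurableT_comp mV2).
    - by move=> j w _; rewrite lee_fin sqr_ge0.
    under eq_bigr => j _.
      rewrite (integral_law z_law j mV2); last by move=> x; rewrite sqr_ge0.
      rewrite V2E; over.
    rewrite sumEFin -EFinM lee_fin sumr_const card_ord -mulr_natl nE.
    by rewrite le_eqVlt; apply/orP; left; apply/eqP; field; rewrite gt_eqF.
  under eq_integral do rewrite mulrC EFinM.
  rewrite ge0_integralZl//; last 3 first.
  - apply/measurable_EFinP; apply: measurable_funX;
    apply: measurable_funB => //.
    exact: mS.
  - by move=> w _; rewrite lee_fin sqr_ge0.
  - by rewrite lee_fin invr_ge0 sqr_ge0.
  have := integral_sqr_sum_indep z_law z_indep (2 ^ k) (mV k) (V0 k) bE V2E.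
  rewrite nE => H; apply: le_trans (lee_wpmul2l _ H) _;
    first by rewrite lee_fin invr_ge0 sqr_ge0.
  rewrite -EFinM lee_fin.
  by rewrite le_eqVlt; apply/orP; left; apply/eqP; field;
    rewrite (gt_eqF n0) (gt_eqF delta_gt0).
have mf : measurable_fun setT f by exact: measurable_funD.
apply: (@le_trans _ _ (P [set w | 1 <= f w])).
  apply: le_measure; rewrite ?inE//; first exact: measurable_ler_set.
  move=> w; rewrite /bad/= nE /f => bw.
  have [/existsP[j hj]|/existsPn hj] := boolP [exists j : 'I_(2 ^ k), n <= h
    (z j w)].
    rewrite -[leLHS]addr0 lerD// ler_pdivlMr ?exprn_gt0// mul1r.
    rewrite /S (bigD1 j)//= -[leLHS]addr0 lerD//.
      by rewrite /V min_r.
    by apply: sumr_ge0 => i _; rewrite sqr_ge0.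
  have SE : S (V k) (2 ^ k) w = S h (2 ^ k) w.
    by apply: eq_bigr => j _; rewrite /V min_l// ltW// ltNge.
  rewrite -[leLHS]add0r lerD// ler_pdivlMr ?exprn_gt0 ?mulr_gt0// mul1r SE.
  have nd : n * delta <= S h (2 ^ k) w - n * b.
    rewrite lerBrDr; apply: le_trans bw; rewrite mulrDr addrC lerD2r.
    by rewrite ler_pM2l.
  have nd0 : 0 <= n * delta by rewrite mulr_ge0// ltW.
  by rewrite !expr2 ler_pM.
have := markov_ge0 mf _ ltr01 fE; rewrite divr1; apply.
by move=> w; rewrite addr_ge0.
Qed.

(** Along the powers of 2 the averages are eventually at most [a + delta], and
    the sums are nondecreasing; comparing with the next power of 2 costs a
    factor 2. *)
Lemma ae_sum_iid_le :
  {ae P, forall w, exists n0, forall N, (n0 <= N)%N ->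
     \sum_(j < N) h (z j w) <= 2 * (a + delta) * N%:R}.
Proof.
have mbad k : measurable (bad k) by apply: measurable_ler_set => //; exact: mS.
have d2 : 0 <= 1 + delta ^- 2 by rewrite addr_ge0// invr_ge0 sqr_ge0.
have a0 : 0 <= a by rewrite -lee_fin -ha integral_ge0// => x _; rewrite lee_fin.
have := @borel_cantelli_ae _ _ _ P bad ((1 + delta ^- 2) * (4 * a)) mbad.
have sumP K : (\sum_(k < K) P (bad k) <= ((1 + delta ^- 2) * (4 * a))%:E)%E.
  apply: (@le_trans _ _ (\sum_(k < K) ((1 + delta ^- 2) * q k)%:E)%E).
    by apply: lee_sum => k _; exact: bad_le.
  rewrite sumEFin -mulr_sumr lee_fin ler_wpM2l// -lee_fin -sumEFin.
  apply: le_trans (sum_u K); apply: lee_sum => k _; by rewrite -qE.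
move=> /(_ sumP); apply: filterS => w [k0 H].
exists (2 ^ k0)%N => N le.
have N0 : (0 < N)%N by apply: leq_trans le; rewrite expn_gt0.
pose k := trunc_log 2 N.
have /andP[kN Nk] : (2 ^ k <= N < 2 ^ k.+1)%N by exact: trunc_log_bounds.
have k0k : (k0 <= k.+1)%N.
  by apply/ltnW; rewrite -(@ltn_exp2l 2)//; exact: leq_ltn_trans Nk.
have := H _ k0k; rewrite /bad/= => /negP; rewrite -ltNge => /ltW lt.
apply: (@le_trans _ _ (S h (2 ^ k.+1) w)).
  rewrite /S -(subnKC (ltnW Nk)) big_split_ord/= lerDl.
  exact: sumr_ge0.
apply: (le_trans lt); rewrite expnS natrM mulrAC.
apply: ler_wpM2l; first by rewrite mulr_ge0// addr_ge0// ltW.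
by rewrite ler_nat.
Qed.

End IidBound.

(** * Truncation of an integrable centred function *)

Section Truncation.
Context d' (E : measurableType d') (R : realType) (L : probability E R).
Variable X : E -> R.
Hypothesis iX : L.-integrable setT (EFin \o X).
Hypothesis X0 : (\int[L]_x (X x)%:E = 0)%E.

Let mX : measurable_fun setT X.
Proof. by apply/measurable_EFinP; exact: measurable_int iX. Qed.

Let small K := [set x | `|X x| <= K].
Let msmall K : measurable (small K).
Proof. by apply: measurable_ler_set => //; exact: measurableT_comp. Qed.

Definition truncated K x := X x * \1_(small K) x.
Definition truncation_error K x := `|X x - truncated K x|.

Lemma truncated_le K x : 0 <= K -> `|truncated K x| <= K.
Proof.
move=> K0; rewrite /truncated indicE; case: (boolP (x \in _)).
  by rewrite inE/= mulr1.
by rewrite mulr0 normr0.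
Qed.

Lemma measurable_truncated K : measurable_fun setT (truncated K).
Proof. by apply: measurable_funM => //; exact: measurable_indic. Qed.

Lemma measurable_truncation_error K : measurable_fun setT (truncation_error K).
Proof.
apply: measurableT_comp => //; apply: measurable_funB => //.
exact: measurable_truncated.
Qed.

Let error_le K x : truncation_error K x <= `|X x|.
Proof.
rewrite /truncation_error /truncated indicE; case: (x \in _).
  by rewrite mulr1 subrr normr0.
by rewrite mulr0 subr0.
Qed.

Lemma truncation_error_small (e : R) : 0 < e ->
  exists2 K, 0 < K & (\int[L]_x (truncation_error K x)%:E <= e%:E)%E.
Proof.
move=> e0.
have := @dominated_cvg _ _ _ L setT measurableT
  (fun n x => (truncation_error n.+1%:R x)%:E) (cst 0%E) (abse \o (EFin \o X)).
move=> H.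
have : (\int[L]_x (truncation_error n.+1%:R x)%:E @[n --> \oo] --> 0)%E.
  rewrite -[X in _ --> X](integral0 L setT); apply: H => //.
  - by move=> n; apply/measurable_EFinP; exact: measurable_truncation_error.
  - move=> x _; apply: cvg_near_cst; near=> n.
    rewrite /truncation_error /truncated indicE mem_set ?mulr1 ?subrr ?normr0//.
    rewrite /small/=; apply: (@le_trans _ _ n%:R); last by rewrite ler_nat.
    by near: n; exact: nbhs_infty_ger.
  - exact: integrable_abse.
  - by move=> n x _ /=; rewrite lee_fin /truncation_error normr_id;
    exact: error_le.
move=> /fine_cvgP[fin /cvgrPdist_le /(_ _ e0) le].
near \oo => n; exists n.+1%:R => //.
rewrite -[leLHS]fineK; last by near: n.
rewrite lee_fin; have : `|0 - fine (\int[L]_x (truncation_error n.+1%:R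
  x)%:E)%E| <= e.
  by near: n.
by rewrite sub0r normrN; apply: le_trans; exact: ler_norm.
Unshelve. all: by end_near. Qed.

Lemma integrable_truncated K : L.-integrable setT (EFin \o truncated K).
Proof.
apply: le_integrable iX => //.
  by apply/measurable_EFinP; exact: measurable_truncated.
move=> x _ /=; rewrite lee_fin /truncated indicE; case: (x \in _).
  by rewrite mulr1.
by rewrite mulr0 normr0.
Qed.

(** As [X] is centred, the mean of its truncation is the opposite of the mean
    of what the truncation removes. *)
Lemma integral_truncated_le K (e : R) :
  (\int[L]_x (truncation_error K x)%:E <= e%:E)%E ->
  (`|\int[L]_x (truncated K x)%:E| <= e%:E)%E.
Proof.
move=> le; apply: le_trans le.
have iD : L.-integrable setT (fun x => (X x - truncated K x)%:E).
  apply: (eq_integrable _ (fun x => (EFin \o X) x - (EFin \o truncated K)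
    x)%E) => //.
  by apply: integrableB => //; exact: integrable_truncated.
have -> : (\int[L]_x (truncated K x)%:E = - \int[L]_x (X x - truncated K
  x)%:E)%E.
  under [in RHS]eq_integral do rewrite EFinB.
  rewrite integralB//; last exact: integrable_truncated.
  by rewrite X0 sub0e oppeK.
rewrite abseN; apply: le_abse_integral => //.
exact: measurable_int iD.
Qed.

End Truncation.

(** * Deviations of the sums along the cycles *)

(** From [expR (- x) >= 1 - x] one gets [expR x <= 1 / (1 - x)]. *)
Lemma expR_le_quadratic (R : realType) (x : R) : x <= 2^-1 ->
  expR x <= 1 + x + 2 * x ^+ 2.
Proof.
move=> x2; have : expR x * (1 - x) <= 1.
  rewrite -[leRHS](expRxMexpNx_1 x) ler_pM2l ?expR_gt0//.
  by rewrite -[- x]/(- x) expR_ge1Dx.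
have e0 := expR_gt0 x.
move=> H; have x1 : 0 < 1 - x by lra.
rewrite -(ler_pM2r x1); apply: (le_trans H).
have -> : (1 + x + 2 * x ^+ 2) * (1 - x) = 1 + x ^+ 2 * (1 - 2 * x) by ring.
by rewrite lerDl mulr_ge0 ?sqr_ge0//; lra.
Qed.

(** The conditions on [lam] make the exponents small enough for
    [expR_le_quadratic] and the quadratic term at most [lam * eps], the size
    allowed for the contribution of the mean. *)
Section Deviation.
Context d' (E : measurableType d') (R : realType) (L : probability E R).
Variables (y : E -> R) (m K lam eps : R).
Hypothesis my : measurable_fun setT y.
Hypothesis yK : forall x, `|y x| <= K.
Hypothesis iy : L.-integrable setT (EFin \o y).
Hypothesis ym : (\int[L]_x (y x)%:E = m%:E)%E.
Hypothesis m_le : `|m| <= eps.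
Hypothesis lam_ge0 : 0 <= lam.
Hypothesis lamK : lam * K <= 2^-1.
Hypothesis lamK2 : 2 * (lam * K ^+ 2) <= eps.

Lemma mgf_le (eta : R) : `|eta| <= 1 ->
  (\int[L]_x (expR (lam * (eta * y x)))%:E <= (expR (2 * lam * eps))%:E)%E.
Proof.
move=> eta1.
have bnd x : `|eta * y x| <= K.
  rewrite normrM; apply: (le_trans _ (yK x)).
  by rewrite ler_piMl.
have le x : expR (lam * (eta * y x)) <= 1 + lam * eps + (lam * eta) * y x.
  apply: (@le_trans _ _ (1 + lam * (eta * y x) + 2 * (lam * (eta * y x)) ^+ 2)).
    apply: expR_le_quadratic; apply: le_trans lamK; rewrite ler_wpM2l//.
    exact: le_trans (ler_norm _) (bnd x).
  have : (eta * y x) ^+ 2 <= K ^+ 2.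
    rewrite -real_normK ?num_real// lerXn2r ?nnegrE//.
    exact: le_trans (bnd x).
  move=> sq; have : lam * (2 * (lam * (eta * y x) ^+ 2)) <= lam * eps.
    rewrite ler_wpM2l//; apply: le_trans lamK2; rewrite ler_pM2l//.
    by rewrite ler_wpM2l.
  have -> : lam * eta * y x = lam * (eta * y x) by ring.
  have -> : 2 * (lam * (eta * y x)) ^+ 2 = lam * (2 * (lam * (eta * y x)
    ^+ 2)) by ring.
  lra.
apply: (@le_trans _ _ (\int[L]_x (1 + lam * eps + (lam * eta) * y x)%:E)%E).
  apply: ge0_le_integral => //.
  - apply/measurable_EFinP; apply: measurableT_comp => //.
    by apply: measurable_funM => //; exact: measurable_funM.
  - apply/measurable_EFinP; apply: measurable_funD => //;
    exact: measurable_funM.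
  - by move=> x _; rewrite lee_fin.
have -> : (\int[L]_x (1 + lam * eps + (lam * eta) * y x)%:E =
    (1 + lam * eps + lam * eta * m)%:E)%E.
  under eq_integral do rewrite EFinD.
  rewrite integralD//=.
  - rewrite integral_cst//= probability_setT mule1.
    under eq_integral do rewrite EFinM.
    by rewrite integralZl// ym.
  - exact: finite_measure_integrable_cst.
  - apply: (eq_integrable _ (fun x => (lam * eta)%:E * (EFin \o y) x)%E) => //.
    exact: integrableZl.
rewrite lee_fin; apply: (@le_trans _ _ (1 + 2 * lam * eps));
  last exact: expR_ge1Dx.
have : eta * m <= eps.
  apply: le_trans (ler_norm _) _; rewrite normrM.
  by apply: le_trans m_le; rewrite ler_piMl.
move=> /(ler_wpM2l lam_ge0); lra.
Qed.

End Deviation.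

Definition cycle_sums (R : realType) N (s : 'S_N) (x : 'I_N -> R) : R :=
  \sum_(c in porbits s) `|\sum_(j in c) x j|.

Lemma sum_porbits (V : nmodType) N (s : 'S_N) (x : 'I_N -> V) :
  \sum_(c in porbits s) \sum_(j in c) x j = \sum_j x j.
Proof.
rewrite (partition_big (porbit s) (mem (porbits s))) => [|j _];
  last exact: imset_f.
apply: eq_bigr => _ /imsetP[k _ ->]; apply: eq_bigl => j.
by rewrite /= eq_porbit_mem.
Qed.

Lemma cycle_sums_le N (R : realType) (s : 'S_N) (x y : 'I_N -> R) :
  cycle_sums s x <= cycle_sums s y + \sum_j `|x j - y j|.
Proof.
rewrite -(sum_porbits s) /cycle_sums -big_split/=; apply: ler_sum => c _.
apply: (@le_trans _ _ (`|\sum_(j in c) y j| + `|\sum_(j in c) (x j - y j)|)).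
  apply: le_trans (ler_normD _ _); rewrite -big_split/=.
  by under [in leRHS]eq_bigr do rewrite addrC subrK.
by rewrite lerD2l; exact: ler_norm_sum.
Qed.

(** The sign attached to the cycle of [j], negative for the cycles in [U]. It
    is indexed by [nat] because the sequence of weights is. *)
Definition cycle_sign (R : realType) n (s : 'S_n.+1) (U : {set {set 'I_n.+1}})
  (j : nat) : R := (-1) ^+ (porbit s (inord j) \in U).

Lemma cycle_sumsE n (R : realType) (s : 'S_n.+1) (x : 'I_n.+1 -> R) :
  exists2 U, U \in powerset (porbits s) &
    cycle_sums s x = \sum_(j < n.+1) cycle_sign R s U j * x j.
Proof.
pose U := [set c in porbits s | \sum_(j in c) x j < 0]%SET.
exists U; first by rewrite powersetE; apply/fintype.subsetP => c;
  rewrite inE => /andP[].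
rewrite -(sum_porbits s); apply: eq_bigr => _ /imsetP[k _ ->].
have -> : \sum_(j in porbit s k) cycle_sign R s U j * x j =
    (-1) ^+ (porbit s k \in U) * \sum_(j in porbit s k) x j.
  rewrite mulr_sumr; apply: eq_bigr => j jk; rewrite /cycle_sign inord_val.
  by move: jk; rewrite -eq_porbit_mem => /eqP ->.
rewrite inE imset_f//=; case: ltP => lt0.
  by rewrite ltr0_norm// expr1 mulN1r.
by rewrite ger0_norm// expr0 mul1r.
Qed.

Lemma measurable_cycle_sums d (T : measurableType d) (R : realType) N (s : 'S_N)
    (x : 'I_N -> T -> R) :
  (forall j, measurable_fun setT (x j)) ->
  measurable_fun setT (fun w => cycle_sums s (x ^~ w)).
Proof.
move=> mx; apply: measurable_sum_cond => c; apply: measurableT_comp => //.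
exact: measurable_sum_cond.
Qed.

Section CycleDeviation.
Context d (T : measurableType d) (R : realType) (P : probability T R).
Context d' (E : measurableType d') (L : probability E R).
Context (z : nat -> {RV P >-> E}).
Hypothesis z_law : forall j A, measurable A -> distribution P (z j) A = L A.
Hypothesis z_indep : mutually_independent P
  (fun j => preimage_set_system setT (z j) measurable).

Variables (y : E -> R) (m K lam eps : R).
Hypothesis my : measurable_fun setT y.
Hypothesis yK : forall x, `|y x| <= K.
Hypothesis iy : L.-integrable setT (EFin \o y).
Hypothesis ym : (\int[L]_x (y x)%:E = m%:E)%E.
Hypothesis m_le : `|m| <= eps.
Hypothesis lam_ge0 : 0 <= lam.
Hypothesis lamK : lam * K <= 2^-1.
Hypothesis lamK2 : 2 * (lam * K ^+ 2) <= eps.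

Let weight (eta : nat -> R) N w := expR (lam * \sum_(j < N) eta j * y (z j w)).

Let measurable_weight eta N : measurable_fun setT (weight eta N).
Proof.
apply: measurableT_comp => //; apply: measurable_funM => //.
apply: measurable_sum => j; apply: measurable_funM => //.
exact: measurableT_comp.
Qed.

Let integral_weight (eta : nat -> R) N : (forall j, `|eta j| <= 1) ->
  (\int[P]_w (weight eta N w)%:E <= (expR (2 * lam * eps) ^+ N)%:E)%E.
Proof.
move=> eta1.
pose g j x := expR (lam * (eta j * y x)).
have mg j : measurable_fun setT (g j).
  apply: measurableT_comp => //; apply: measurable_funM => //.
  exact: measurable_funM.
have g0 j x : 0 <= g j x by exact: expR_ge0.
have gle j : (\int[L]_x (g j x)%:E <= (expR (2 * lam * eps))%:E)%E.
  exact: (mgf_le my yK iy ym m_le lam_ge0 lamK lamK2).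
have wE w : weight eta N w = \prod_(j <- index_iota 0 N) g j (z j w).
  by rewrite big_mkord -expR_sum -mulr_sumr.
under eq_integral do rewrite wE.
pose c j := fine (\int[L]_x (g j x)%:E)%E.
have cE j : (\int[L]_x (g j x)%:E = (c j)%:E)%E.
  rewrite fineK// ge0_fin_numE; last by apply: integral_ge0 => x _;
    rewrite lee_fin.
  by apply: le_lt_trans (gle j) _; exact: ltry.
rewrite (integral_prod_indep z_indep (c := c)) ?iota_uniq//; last first.
  by move=> j; rewrite (integral_law z_law j (mg j) (g0 j)).
rewrite lee_fin big_mkord.
have -> : expR (2 * lam * eps) ^+ N = \prod_(j < N) expR (2 * lam * eps).
  by rewrite prodr_const card_ord.
apply: ler_prod => j _; apply/andP; split; last by rewrite -lee_fin -cE.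
by rewrite -lee_fin -cE; apply: integral_ge0 => x _; rewrite lee_fin.
Qed.

(** A union bound over the sets [U] of cycles that are counted negatively,
    carried out on the exponential moments. *)
Lemma prob_cycle_sums_le n (s : 'S_n.+1) :
  (P [set w | (4 * eps * n.+1%:R <= cycle_sums s (fun j => y (z j w)))%R] <=
   (2 ^+ #|porbits s| * expR (- (2 * lam * eps) * n.+1%:R))%:E)%E.
Proof.
pose f w := \sum_(U <- enum (powerset (porbits s))) weight (cycle_sign R s U)
  n.+1 w.
have mf : measurable_fun setT f by apply: measurable_sum => U;
  exact: measurable_weight.
have f0 w : 0 <= f w by apply: sumr_ge0 => U _; exact: expR_ge0.
have fle : (\int[P]_w (f w)%:E <=
    (2 ^+ #|porbits s| * expR (2 * lam * eps) ^+ n.+1)%:E)%E.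
  under eq_integral do rewrite /f -sumEFin.
  rewrite ge0_integral_sum//; last 2 first.
  - by move=> U; apply/measurable_EFinP; exact: measurable_weight.
  - by move=> U w _; rewrite lee_fin expR_ge0.
  have sgn1 U j : `|cycle_sign R s U j| <= 1 by rewrite normr_sign.
  apply: (@le_trans _ _ (\sum_(U <- enum (powerset (porbits s))) (expR (2
    * lam * eps) ^+ n.+1)%:E)%E).
    by apply: lee_sum => U _; exact: integral_weight.
  rewrite sumEFin big_enum sumr_const card_powerset lee_fin.
  by rewrite -[leLHS]mulr_natl natrX.
have c0 : 0 < expR (lam * (4 * eps * n.+1%:R)) by exact: expR_gt0.
apply: (@le_trans _ _ (P [set w | expR (lam * (4 * eps * n.+1%:R)) <= f w])).
  apply: le_measure; rewrite ?inE//.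
  - apply: measurable_ler_set => //.
    by apply: measurable_cycle_sums => j; exact: measurableT_comp.
  - exact: measurable_ler_set.
  move=> w /=; have [U Us ->] := cycle_sumsE s (fun j => y (z j w)) => le.
  rewrite /f big_enum (bigD1 U)//= -[leLHS]addr0 lerD//.
    by rewrite ler_expR ler_wpM2l.
  by apply: sumr_ge0 => V _; exact: expR_ge0.
apply: (le_trans (markov_ge0 mf f0 c0 fle)).
rewrite lee_fin -mulrA ler_wpM2l ?exprn_ge0//.
rewrite -expRM_natr -expRN -expRD ler_expR.
by rewrite le_eqVlt; apply/orP; left; apply/eqP; ring.
Qed.

End CycleDeviation.

Section EwensAlmostSurely.
Context d (T : measurableType d) (R : realType) (P : probability T R).
Variables (theta : R) (sigma : forall n, T -> 'S_n.+1).
Hypothesis theta_gt0 : 0 < theta.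

(** An event whose conditional probability given the permutation is at most
    2 ^ cycles times an exponentially small factor occurs finitely often: half
    of the exponential rate pays for the mean of 2 ^ cycles. *)
Lemma ae_ewens (B : forall n, 'S_n.+1 -> set T) (kappa : R) : 0 < kappa ->
  (forall n s, measurable (sigma n @^-1` [set s] `&` B n s)) ->
  (forall n s, P (sigma n @^-1` [set s] `&` B n s) <=
    (ewens theta s * 2 ^+ #|porbits s| * expR (- kappa * n.+1%:R))%:E)%E ->
  {ae P, forall w, exists n0, forall n, (n0 <= n)%N -> ~ B n (sigma n w) w}.
Proof.
move=> k0 mB PB.
pose A n := [set w | B n (sigma n w) w].
have AE n : A n = \bigcup_s (sigma n @^-1` [set s] `&` B n s).
  apply/seteqP; split => w /=; first by exists (sigma n w).
  by move=> [s _ []] /= <-.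
have mA n : measurable (A n).
  by rewrite AE; apply: fin_bigcup_measurable => [|s _];
    [exact: finite_finset|exact: mB].
have rho1 : 1 < expR (kappa / 2) by rewrite expR_gt1 divr_gt0.
have [C C0 CE] := ewens_exp2_porbits_le theta_gt0 rho1.
pose q := expR (- (kappa / 2)).
have q1 : q < 1 by rewrite expR_lt1 oppr_lt0 divr_gt0.
have q0 : 0 < q by exact: expR_gt0.
have PA n : (P (A n) <= (C * q ^+ n.+1)%:E)%E.
  apply: (@le_trans _ _ (\sum_s P (sigma n @^-1` [set s] `&` B n s))%E).
    by apply: prob_le_sum => //; rewrite AE.
  apply: (@le_trans _ _ (\sum_(s : 'S_n.+1)
      (ewens theta s * 2 ^+ #|porbits s| * expR (- kappa * n.+1%:R))%:E)%E).
    by apply: lee_sum => s _; exact: PB.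
  rewrite sumEFin lee_fin -mulr_suml.
  have -> : q ^+ n.+1 = expR (kappa / 2) ^+ n.+1 * expR (- kappa * n.+1%:R).
    by rewrite -!expRM_natr -expRD; congr expR; field.
  by rewrite mulrA ler_wpM2r ?expR_ge0.
apply: (borel_cantelli_ae (c := C * (q / (1 - q)))) mA _ => k.
apply: (@le_trans _ _ (\sum_(n < k) (C * q ^+ n.+1)%:E)%E).
  by apply: lee_sum => n _; exact: PA.
rewrite sumEFin lee_fin -mulr_sumr ler_pM2l//.
under eq_bigr do rewrite exprS.
rewrite -mulr_sumr ler_pM2l// -(ler_pM2l (_ : 0 < 1 - q)) ?subr_gt0//.
rewrite divff ?gt_eqF ?subr_gt0//.
have -> : (1 - q) * \sum_(i < k) q ^+ i = 1 - q ^+ k.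
  by rewrite -opprB mulNr -subrX1 opprB.
by rewrite gerBl exprn_ge0// ltW.
Qed.

End EwensAlmostSurely.

(** * Almost sure behaviour of the cycles *)

Section EwensModel.
Context d (T : measurableType d) (R : realType) (P : probability T R).
Variables (theta : R) (L : probability R[i] R).
Variables (sigma : forall n, T -> 'S_n.+1) (z : nat -> {RV P >-> R[i]}).
Hypothesis theta_gt0 : 0 < theta.
Hypothesis model : ewens_model theta L P sigma z.

(** For a fixed permutation the event only involves the weights, so that it
    belongs to the sigma-algebra that they generate. *)
Lemma prob_sigma_cycle_sums n (s : 'S_n.+1) (y : R[i] -> R) (t : R) :
  measurable_fun setT y ->
  (P (sigma n @^-1` [set s] `&`
     [set w | (t <= cycle_sums s (fun j => y (z j w)))%R]) =
  (ewens theta s)%:E *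
    P [set w | (t <= cycle_sums s (fun j => y (z j w)))%R])%E.
Proof.
move=> my; rewrite -(ewens_model_sigma model s).
apply: (ewens_model_indep model).
  apply: sub_sigma_algebra; exists n => //; exists [set s] => //.
  by rewrite setTI.
(* Measurability is proved on [T] with the sigma-algebra generated by [G]. *)
pose G := \bigcup_j preimage_set_system setT (z j) measurable.
apply: (@measurable_ler_set _ (g_sigma_algebraType G) R (cst t)) => //.
apply: measurable_cycle_sums => j.
apply: (measurableT_comp my) => _ B mB.
by apply: sub_sigma_algebra; exists (j : nat) => //; exists B.
Qed.

Lemma ae_card_porbits_le (eps : R) : 0 < eps ->
  {ae P, forall w, exists n0, forall n, (n0 <= n)%N ->
     #|porbits (sigma n w)|%:R <= eps * n.+1%:R}.
Proof.
move=> eps0.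
pose B n (s : 'S_n.+1) := [set w : T | eps * n.+1%:R <= #|porbits s|%:R].
have mB n (s : 'S_n.+1) : measurable (B n s) by exact: measurable_ler_set.
have msig n (s : 'S_n.+1) : measurable (sigma n @^-1` [set s]).
  exact: (ewens_model_measurable model).
have := @ae_ewens _ _ _ P theta sigma theta_gt0 B (eps / 2).
rewrite divr_gt0// => /(_ isT); have mI n s := measurableI _ _ (msig n s) (mB
  n s).
move=> /(_ mI) H; apply: filterS (H _) => [w [n0 Hw]|n s].
  exists n0 => n nn0; have := Hw n nn0; rewrite /B/= => /negP.
  by rewrite -ltNge => /ltW.
have [le|lt] := leP (eps * n.+1%:R) #|porbits s|%:R; last first.
  have -> : sigma n @^-1` [set s] `&` B n s = set0.
    by apply/seteqP; split => // w [_]; rewrite /B/= leNgt lt.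
  by rewrite measure0 lee_fin mulr_ge0 ?expR_ge0// mulr_ge0 ?exprn_ge0//
    ewens_ge0.
apply: (@le_trans _ _ (P (sigma n @^-1` [set s]))).
  by apply: le_measure; rewrite ?inE//; exact: subIsetl.
rewrite [X in (X <= _)%E](ewens_model_sigma model) lee_fin -mulrA.
rewrite -[leLHS]mulr1 ler_wpM2l ?ewens_ge0//.
(* Hence 2 ^ cycles >= expR (cycles / 2) >= expR (eps / 2 * n.+1). *)
have e2 : expR 2^-1 <= 2 :> R.
  apply: le_trans (expR_le_quadratic (lexx _)) _; lra.
apply: (@le_trans _ _ (expR 2^-1 ^+ #|porbits s| * expR (- (eps / 2)
  * n.+1%:R))).
  rewrite -expRM_natr -expRD -[leLHS]expR0 ler_expR.
  by move: le; set k := #|_|%:R; set N := n.+1%:R; lra.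
rewrite ler_wpM2r ?expR_ge0// lerXn2r ?nnegrE ?expR_ge0//.
Qed.

Lemma ae_cycle_sums_le (X : R[i] -> R) (eps : R) :
  L.-integrable setT (EFin \o X) -> (\int[L]_x (X x)%:E = 0)%E -> 0 < eps ->
  {ae P, forall w, exists n0, forall n, (n0 <= n)%N ->
     cycle_sums (sigma n w) (fun j => X (z j w)) <= 8 * eps * n.+1%:R}.
Proof.
move=> iX X0 eps0.
have [K K0 errK] := truncation_error_small iX eps0.
pose y := truncated X K.
have my : measurable_fun setT y by exact: measurable_truncated iX K.
have iy : L.-integrable setT (EFin \o y) by exact: integrable_truncated.
pose m := fine (\int[L]_x (y x)%:E)%E.
have ym : (\int[L]_x (y x)%:E = m%:E)%E by rewrite fineK//;
  exact: integrable_fin_num iy.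
have m_le : `|m| <= eps.
  by rewrite -lee_fin; have := integral_truncated_le iX X0 errK; rewrite -/y ym.
(* The largest [lam] allowed by [mgf_le]. *)
pose lam := Num.min (2^-1 / K) (eps / (2 * K ^+ 2)).
have K2 : 0 < 2 * K ^+ 2 by rewrite mulr_gt0// exprn_gt0.
have lam0 : 0 < lam by rewrite lt_min !divr_gt0.
have lamK : lam * K <= 2^-1 by rewrite -ler_pdivlMr// ge_min lexx.
have lamK2 : 2 * (lam * K ^+ 2) <= eps.
  by rewrite mulrCA -ler_pdivlMr// ge_min lexx orbT.
have yK x : `|y x| <= K by apply: truncated_le; exact: ltW.
pose B n (s : 'S_n.+1) :=
  [set w | 4 * eps * n.+1%:R <= cycle_sums s (fun j => y (z j w))].
have mB n (s : 'S_n.+1) : measurable (B n s).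
  apply: measurable_ler_set => //; apply: measurable_cycle_sums => j.
  exact: measurableT_comp.
have msig n (s : 'S_n.+1) : measurable (sigma n @^-1` [set s]).
  exact: (ewens_model_measurable model).
have mI n s := measurableI _ _ (msig n s) (mB n s).
have ae1 : {ae P, forall w, exists n0, forall n, (n0 <= n)%N -> ~ B n (sigma n
  w) w}.
  apply: (ae_ewens theta_gt0 (_ : 0 < 2 * lam * eps)) mI _.
    by rewrite !mulr_gt0.
  move=> n s; rewrite prob_sigma_cycle_sums//.
  rewrite -[(ewens theta s * _ * _)%R]mulrA [leRHS]EFinM.
  apply: lee_wpmul2l; first by rewrite lee_fin ewens_ge0.
  exact: (prob_cycle_sums_le (ewens_model_z model) (ewens_model_z_indep model)
    my yK iy ym m_le (ltW lam0) lamK lamK2).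
pose h := truncation_error X K.
have mh : measurable_fun setT h by exact: measurable_truncation_error iX K.
have h0 x : 0 <= h x by exact: normr_ge0.
pose a := fine (\int[L]_x (h x)%:E)%E.
have ha : (\int[L]_x (h x)%:E = a%:E)%E.
  rewrite fineK// ge0_fin_numE; last by apply: integral_ge0 => x _;
    rewrite lee_fin.
  by apply: le_lt_trans errK _; exact: ltry.
have a_le : a <= eps by rewrite -lee_fin -ha.
have ae2 := ae_sum_iid_le (ewens_model_z model) (ewens_model_z_indep model)
  mh h0 ha eps0.
apply: filterS2 ae1 ae2 => w [n1 H1] [n2 H2].
exists (maxn n1 n2) => n; rewrite geq_max => /andP[n1n n2n].
apply: le_trans (cycle_sums_le _ _ (fun j => y (z j w))) _.
have := H1 n n1n; rewrite /B/= => /negP; rewrite -ltNge => /ltW le1.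
have le2 := H2 n.+1 (leqW n2n).
have -> : 8 * eps * n.+1%:R = 4 * eps * n.+1%:R + 2 * (eps + eps) * n.+1%:R by
  ring.
apply: lerD => //; apply: (le_trans le2).
by rewrite ler_wpM2r// ler_wpM2l// lerD2r.
Qed.

End EwensModel.

(** * Integrals against the spectral measure *)

Section SpectralIntegral.
Variables (R : realType) (n : nat) (M : 'M[R[i]]_n.+1) (lam : 'I_n.+1 -> R[i]).
Hypothesis char_polyE : char_poly M = \prod_k ('X - (lam k)%:P).

(** The multiplicity of an eigenvalue is the number of its occurrences among
    the [lam k]. *)
Lemma spectral_measure_msum A :
  spectral_measure M A =
  msum (fun k => @dirac _ _ (lam (inord k)) R) n.+1 A.
Proof.
pose eigs := [seq lam k | k <- enum 'I_n.+1].
have cE : char_poly M = \prod_(z <- eigs) ('X - z%:P).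
  by rewrite char_polyE big_map big_enum.
have -> : msum (fun k => @dirac _ _ (lam (inord k)) R) n.+1 A =
    (\sum_(l <- eigs) @dirac _ _ l R A)%E.
  rewrite /msum/= big_map big_enum/=; apply: eq_bigr => k _.
  by rewrite inord_val.
rewrite /spectral_measure.
have -> : [set l | eigenvalue M l] = [set` undup eigs].
  apply/seteqP; split=> l /=;
  by rewrite eigenvalue_root_char cE root_prod_XsubC mem_undup.
rewrite -fsbig_seq ?undup_uniq// -[RHS]big_undup_iterop_count.
apply: eq_bigr => l _; rewrite cE mu_prod_XsubC /dirac.
elim: (count_mem l eigs) => [|k IH]; first by rewrite mul0e.
rewrite [RHS]Monoid.iteropE iterS -Monoid.iteropE -IH -!EFinM.
by rewrite -natr1 mulrDl mul1r addrC EFinD.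
Qed.

Lemma integral_spectral_prob (f : R[i] -> R) : measurable_fun setT f ->
  (\int[spectral_prob M]_x (f x)%:E = (n.+1%:R^-1 * \sum_k f (lam k))%:E)%E.
Proof.
move=> mf.
have ge0 (g : R[i] -> \bar R) : measurable_fun setT g -> (forall x, 0 <= g
  x)%E ->
    (\int[spectral_prob M]_x g x =
     (n.+1%:R^-1)%:E * \sum_k g (lam k))%E.
  move=> mg g0; rewrite /spectral_prob ge0_integral_mscale//; congr (_ * _)%E.
  rewrite (@eq_measure_integral _ _ _ _
    (msum (fun k => @dirac _ _ (lam (inord k)) R) n.+1)); last first.
    by move=> A _ _; exact: spectral_measure_msum.
  rewrite ge0_integral_measure_sum//; apply: eq_bigr => k _.
  by rewrite integral_dirac// diracT mul1e inord_val.
have mF : measurable_fun setT (EFin \o f) by exact/measurable_EFinP.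
rewrite integralE ge0//; last exact: measurable_funepos.
rewrite ge0//; last exact: measurable_funeneg.
have pE x : ((EFin \o f)^\+ x)%E = (Num.max (f x) 0)%:E.
  by rewrite [funepos]unlock/= EFin_max.
have nE x : ((EFin \o f)^\- x)%E = (Num.max (- f x) 0)%:E.
  by rewrite [funeneg]unlock/= EFin_max.
under eq_bigr do rewrite pE.
under [in X in (_ - X)%E]eq_bigr do rewrite nE.
rewrite !sumEFin -!EFinM -EFinB -mulrBr -sumrB; congr (_ * _)%:E.
apply: eq_bigr => k _; case: (leP 0 (f (lam k))) => f0.
  by rewrite max_r ?subr0// oppr_le0.
by rewrite max_l ?oppr_ge0 ?ltW// sub0r opprK.
Qed.

End SpectralIntegral.

(** * Equidistribution on a circle *)

Section RiemannSum.
Variable R : realType.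
Let U : probability (measurableTypeR R) R := uniform_prob (lt0_2pi R).

Let uniform_itv (a b : R) : 0 <= a -> a < b -> b <= 2 * pi ->
  U `[a, b[%classic = ((b - a) / (2 * pi))%:E.
Proof.
move=> a0 ab bpi.
have mJ : measurable (`[a, b[%classic : set (measurableTypeR R)) by
  exact: measurable_itv.
have -> : U `[a, b[%classic = (\int[U]_t (\1_(`[a, b[%classic : set R) t)%:E)%E.
  rewrite integral_indic; [by rewrite setIT|exact: measurableT|exact: mJ].
rewrite /U integral_uniform; last 2 first.
- apply/measurable_EFinP; apply: measurable_indic; exact: mJ.
- by move=> t; rewrite lee_fin.
rewrite subr0 integral_indic; [|exact: measurable_itv|exact: mJ].
have -> : `[a, b[ `&` `[0, 2 * pi] = `[a, b[%classic.
  apply/setIidPl => t; rewrite /= !in_itv/= => /andP[kt tk].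
  by rewrite (le_trans a0 kt)/= (le_trans (ltW tk)).
have mE : lebesgue_measure (`[a, b[%classic : set R) = (b - a)%:E.
  by rewrite lebesgue_measure_itv/= lte_fin ab EFinB.
by rewrite [X in (_ * X)%E](_ : _ = (b - a)%:E) -?EFinM ?[(b - a) * _]mulrC.
Qed.

(** The values [v k] need not be values of [g] itself: they will be those of
    the same function on a nearby circle. *)
Lemma riemann_sum_uniform (g : R -> R) (l : nat) (v : 'I_l -> R) (eps C : R) :
  (0 < l)%N -> measurable_fun setT g -> (forall t, `|g t| <= C) ->
  (forall (k : 'I_l) t, 2 * pi / l%:R * k%:R <= t <= 2 * pi / l%:R * k.+1%:R ->
     `|v k - g t| <= eps) ->
  `|l%:R^-1 * \sum_k v k - fine (\int[U]_t (g t)%:E)%E| <= eps.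
Proof.
move=> l0 mg gC vg.
have pi0 := pi_gt0 R.
have eps0 : 0 <= eps.
  apply: le_trans (vg (Ordinal l0) 0 _) => //=.
  by rewrite mulr0 lexx/= mulr1 divr_ge0 ?mulr_ge0 ?ltW ?ltr0n.
pose h : R := 2 * pi / l%:R.
have lR : 0 < l%:R :> R by rewrite ltr0n.
have h0 : 0 < h by rewrite divr_gt0// mulr_gt0.
have hl : h * l%:R = 2 * pi by rewrite mulfVK// gt_eqF.
pose J (k : nat) := `[h * k%:R, h * k.+1%:R[%classic : set R.
have mJ k : measurable (J k) by exact: measurable_itv.
have hk0 (k : nat) : 0 <= h * k%:R by apply: mulr_ge0 => //; exact: ltW.
have hS k : h * k.+1%:R - h * k%:R = h by rewrite -mulrBr -natrB// subSnn mulr1.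
have UJ (k : 'I_l) : U (J k) = (l%:R^-1)%:E.
  rewrite (uniform_itv (hk0 k)) ?hS//.
  - by congr EFin; rewrite /h mulrAC divff ?mul1r// gt_eqF// mulr_gt0.
  - by rewrite -subr_gt0 hS.
  - by rewrite -hl ler_wpM2l ?ler_nat// ltW.
pose s t := \sum_(k < l) v k * \1_(J k) t.
have ind_int (k : nat) : U.-integrable setT (fun t => (\1_(J k) t)%:E).
  by apply: integrable_indic; exact: mJ.
have vint (k : 'I_l) : U.-integrable setT (fun t => (v k * \1_(J k) t)%:E).
  exact: (integrableZl measurableT (v k) (ind_int k)).
have ig : U.-integrable setT (EFin \o g).
  apply: measurable_bounded_integrable => //.
    by rewrite [X in (X < _)%E]probability_setT ltry.
  exists C; split; first exact: num_real.
  by move=> M CM t _; exact: le_trans (gC t) (ltW CM).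
have is_ : U.-integrable setT (fun t => (s t)%:E).
  rewrite (_ : (fun t => _) = fun t => (\sum_(k < l) (v k * \1_(J k) t)%:E)%E).
    by apply: integrable_sum => // k _; exact: vint.
  by apply/funext => t; rewrite /s sumEFin.
have sE : (\int[U]_t (s t)%:E = (l%:R^-1 * \sum_k v k)%:E)%E.
  under eq_integral do rewrite /s -sumEFin.
  rewrite integral_sum//.
  rewrite mulr_sumr -sumEFin; apply: eq_bigr => k _.
  apply: (etrans (integralZl measurableT (ind_int k) (v k))).
  have -> : (\int[U]_t (\1_(J k) t)%:E = U (J k))%E.
    rewrite integral_indic; [by rewrite setIT|exact: measurableT|exact: mJ].
  by rewrite UJ -EFinM mulrC.
have gfin : (\int[U]_t (g t)%:E)%E \is a fin_num by exact: integrable_fin_num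
  ig.
(* Outside of [D] the step function [s] vanishes; this is a null set because
   [2 * pi] has mass 0. *)
pose D := `[0, 2 * pi[%classic : set (measurableTypeR R).
have mD : measurable D by exact: measurable_itv.
have UD : U (~` D) = 0%E.
  rewrite probability_setC// uniform_itv ?mulr_gt0// subr0 divff ?gt_eqF
    ?mulr_gt0//.
  by rewrite subee.
have sg t : `|s t - g t| <= eps + C * \1_(~` D) t.
  have [tD|tD] := boolP (t \in D); last first.
    rewrite indicE mem_set; last by move: tD; rewrite notin_setE.
    rewrite mulr1 /s big1 ?sub0r ?normrN => [|k _].
      by apply: le_trans (gC t) _; rewrite lerDr.
    rewrite indicE memNset ?mulr0// => tJ; move: tD; rewrite notin_setE; apply.
    move: tJ; rewrite /J/D/= !in_itv/= => /andP[kt tk].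
    rewrite (le_trans (hk0 k) kt)/=.
    by apply: (lt_le_trans tk); rewrite -hl ler_wpM2l ?ler_nat// ltW.
  rewrite indicE memNset ?mulr0 ?addr0; last by apply; move: tD; rewrite inE.
  move: tD; rewrite inE /D/= in_itv/= => /andP[t0 t2].
  pose k := Num.truncn (t / h).
  have /andP[kt tk] : k%:R <= t / h < k.+1%:R by apply: truncn_itv;
    rewrite divr_ge0// (ltW h0).
  move: kt tk; rewrite ler_pdivlMr// ltr_pdivrMr// ![_ * h]mulrC => kt tk.
  have kl : (k < l)%N by rewrite -(ltr_nat R) -(ltr_pM2l h0) hl (le_lt_trans
    kt).
  rewrite /s (bigD1 (Ordinal kl))//= indicE mem_set; last first.
    by rewrite /J/= in_itv/= kt.
  rewrite mulr1 big1 ?addr0 => [|j jk].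
    by apply: vg => /=; rewrite -/h kt/= ltW.
  rewrite indicE memNset ?mulr0//; rewrite /J/= in_itv/= => /andP[jt tj].
  move: jk; rewrite -val_eqE/= => /eqP; apply; apply/eqP; rewrite eqn_leq.
  by apply/andP; split; rewrite -ltnS -(ltr_nat R) -(ltr_pM2l h0);
    [exact: le_lt_trans jt tk|exact: le_lt_trans kt tj].
have iD : U.-integrable setT (fun t => (\1_(~` D) t)%:E).
  by apply: integrable_indic; exact: measurableC.
rewrite -lee_fin -abse_EFin EFinB fineK// -sE.
have /= <- := integralB measurableT is_ ig.
apply: (@le_trans _ _ (\int[U]_t (eps%:E + C%:E * (\1_(~` D) t)%:E)%E)%E).
  have msg : measurable_fun setT (fun t => s t - g t).
    apply: measurable_funB => //; apply/measurable_EFinP;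
      exact: measurable_int is_.
  apply: (le_trans (le_abse_integral _ _ _)) => //;
    first exact/measurable_EFinP.
  apply: ge0_le_integral => //.
  - by apply/measurable_EFinP; exact: measurableT_comp.
  - apply/measurable_EFinP; apply: measurable_funD => //.
    by apply: measurable_funM => //; apply: measurable_indic;
      exact: measurableC.
  - by move=> t _; rewrite -EFinB -EFinM -EFinD lee_fin; exact: sg.
have iC : U.-integrable setT (fun t => (C%:E * (\1_(~` D) t)%:E)%E).
  exact: (integrableZl measurableT C iD).
have ie : U.-integrable setT (cst eps%:E) by
  exact: finite_measure_integrable_cst.
have -> : (\int[U]_t (eps%:E + C%:E * (\1_(~` D) t)%:E) =
    \int[U]_t eps%:E + \int[U]_t (C%:E * (\1_(~` D) t)%:E))%E.
  exact: (integralD measurableT ie iC).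
have -> : (\int[U]_t (C%:E * (\1_(~` D) t)%:E) = 0)%E.
  apply: (etrans (integralZl measurableT iD C)).
  rewrite integral_indic; [|exact: measurableT|exact: measurableC].
  by rewrite setIT [X in (_ * X)%E]UD mule0.
have -> : (\int[U]_t eps%:E = eps%:E)%E.
  by rewrite integral_cst//= [X in (_ * X)%E]probability_setT mule1.
by rewrite adde0.
Qed.

End RiemannSum.

Lemma measurable_continuous_complex (R : realType) (f : R[i] -> R) :
  continuous f -> measurable_fun setT f.
Proof.
move=> cf; apply: (@measurability _ _ _ _ setT _ (@RGenOInfty.G R)).
  exact: RGenOInfty.measurableE.
move=> _ [_ [x ->] <-]; rewrite setTI; apply: sub_sigma_algebra.
apply: open_comp => //; exact: open_gt.
Qed.

Section PolarContinuity.
Variable R : realType.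

Lemma continuous_polar : continuous (fun p : R * R => circle_param (expR p.1)
  p.2).
Proof.
have -> : (fun p : R * R => circle_param (expR p.1) p.2) =
    (fun p => (expR p.1 * cos p.2)%:C%C + 'i%C * (expR p.1 * sin p.2)%:C%C).
  by apply/funext => p; rewrite /circle_param; simpc.
move=> p; apply: cvgD.
  apply: (@continuous_comp _ _ _ (fun p : R * R => expR p.1 * cos p.2)
            (fun x : R => x%:C%C)); last exact: continuous_real_complex.
  apply: cvgM.
    apply: (@continuous_comp _ _ _ fst expR);
      [exact: cvg_fst|exact: continuous_expR].
  apply: (@continuous_comp _ _ _ snd cos);
    [exact: cvg_snd|exact: continuous_cos].
apply: cvgM; first exact: cvg_cst.
apply: (@continuous_comp _ _ _ (fun p : R * R => expR p.1 * sin p.2)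
          (fun x : R => x%:C%C)); last exact: continuous_real_complex.
apply: cvgM.
  apply: (@continuous_comp _ _ _ fst expR);
    [exact: cvg_fst|exact: continuous_expR].
apply: (@continuous_comp _ _ _ snd sin); [exact: cvg_snd|exact: continuous_sin].
Qed.

(** Heine's theorem in polar coordinates, at the points of the compact circle
    of radius [expR m] only. *)
Lemma polar_uniform_continuity (f : R[i] -> R) (m eps : R) :
  continuous f -> 0 < eps ->
  exists2 del, 0 < del & forall a s t, 0 <= s <= 2 * pi ->
    `|a - m| <= del -> `|t - s| <= del ->
    `|f (circle_param (expR a) t) - f (circle_param (expR m) s)| <= eps.
Proof.
move=> cf eps0.
pose F (p : R * R) := f (circle_param (expR p.1) p.2).
have cF : continuous F.
  by move=> p; apply: continuous_comp; [exact: continuous_polar|exact: cf].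
have := @segment_compact R 0 (2 * pi); rewrite compact_near_coveringP => cov.
pose Q (del s : R) := forall a t, `|a - m| <= del -> `|t - s| <= del ->
    `|F (a, t) - F (m, s)| <= eps.
have : \forall del \near 0^'+, `[0, 2 * pi]%classic `<=` (Q del).
  apply: cov => s0 _.
  have e2 : 0 < eps / 2 by rewrite divr_gt0.
  have /cvgrPdist_lt /(_ _ e2) := cF (m, s0).
  move=> /nbhs_ballP[r /= r0 br].
  have r2 : 0 < r / 2 by rewrite divr_gt0.
  near=> s del => a t /= am ts.
  have ss0 : `|s0 - s| < r / 2.
    by near: s; apply: nbhsx_ballx.
  have dr : del < r / 2 by near: del; exact: nbhs_right_lt.
  have b1 : ball (m, s0) r (a, t).
    split => /=; rewrite /ball/=.
      by rewrite distrC; lra.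
    rewrite (_ : s0 - t = (s0 - s) - (t - s)); last by ring.
    by apply: le_lt_trans (ler_normB _ _) _; lra.
  have b2 : ball (m, s0) r (m, s).
    by split => /=; rewrite /ball/= ?subrr ?normr0//; lra.
  have h1 := br _ b1; have h2 := br _ b2.
  rewrite (_ : F (a, t) - F (m, s) =
     (F (m, s0) - F (m, s)) - (F (m, s0) - F (a, t))); last by ring.
  apply: le_trans (ler_normB _ _) _.
  by move: h1 h2 => /=; lra.
move=> H; near (0 : R)^'+ => del.
have Hd : `[0, 2 * pi]%classic `<=` Q del by near: del.
exists del; first by near: del; exact: nbhs_right_gt.
by move=> a s t s2 am ts; apply: Hd => //=; rewrite in_itv.
Unshelve. all: by end_near. Qed.

End PolarContinuity.

(** * The eigenvalues in polar form *)

Section CircleParam.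
Variable R : realType.
Implicit Types a b s t : R.

Lemma circle_paramM a b s t :
  circle_param a s * circle_param b t = circle_param (a * b) (s + t).
Proof.
rewrite /circle_param; simpc; rewrite cosD sinD.
by congr (_ +i* _)%C; ring.
Qed.

Lemma circle_paramX a t n :
  circle_param a t ^+ n = circle_param (a ^+ n) (n%:R * t).
Proof.
elim: n => [|n IH].
  by rewrite !expr0 mul0r /circle_param cos0 sin0 mulr1 mulr0.
by rewrite exprS IH circle_paramM exprS -nat1r mulrDl mul1r.
Qed.

Lemma circle_param_periodic a t n :
  circle_param a (t + 2 * pi * n%:R) = circle_param a t.
Proof.
rewrite mulr_natl mulr_natr /circle_param.
by rewrite (periodicn (@cosD2pi R)) (periodicn (@sinD2pi R)).
Qed.

Lemma circle_param_inj a s t : 0 < a -> `|s - t| < 2 * pi ->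
  circle_param a s = circle_param a t -> s = t.
Proof.
move=> a0; wlog ts : s t / t <= s => [H|].
  have [ts|/ltW st] := leP t s; first exact: H.
  by move=> d e; apply/esym/H => //; rewrite distrC.
rewrite ger0_norm ?subr_ge0// => d [/(mulfI (lt0r_neq0 a0)) c /(mulfI
  (lt0r_neq0 a0)) sE].
have cst : cos (s - t) = 1 by rewrite cosB c sE -!expr2 cos2Dsin2.
pose x := (s - t) / 2.
have : sin x ^+ 2 = 0.
  have : cos (x + x) = 1 by rewrite -cst; congr cos; rewrite /x; field.
  rewrite cosD -!expr2 cos2sin2; lra.
move/eqP; rewrite sqrf_eq0 => /eqP sx0.
apply/eqP; rewrite eq_le ts andbT leNgt; apply/negP => st.
have /sin_gt0_pi : 0 < x < pi by rewrite /x; apply/andP; split; lra.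
by rewrite sx0 ltxx.
Qed.

Lemma polar_decomposition (w : R[i]) :
  exists2 phi, 0 <= phi <= 2 * pi & w = circle_param (normc w) phi.
Proof.
have [->|w0] := eqVneq w 0.
  exists 0; first by rewrite lexx mulr_ge0// pi_ge0.
  by rewrite normc0 /circle_param !mul0r.
have r0 : 0 < normc w.
  rewrite lt_neqAle; apply/andP; split; last by case: (w) => x y;
    exact: sqrtr_ge0.
  by apply: contra_neq w0 => /esym/eq0_normc.
case: w r0 {w0} => x y; set r := normc _ => r0.
have rE : r ^+ 2 = x ^+ 2 + y ^+ 2.
  by rewrite /r/= sqr_sqrtr// addr_ge0 ?sqr_ge0.
have rn := lt0r_neq0 r0.
have x1 : -1 <= x / r <= 1.
  rewrite -ler_norml normrM normfV (gtr0_norm r0) ler_pdivrMr// mul1r.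
  rewrite -(@ler_pXn2r _ 2) ?nnegrE ?(ltW r0)// real_normK ?num_real//.
  by rewrite rE lerDl sqr_ge0.
have ca : cos (acos (x / r)) = x / r by rewrite acosK// in_itv.
have sa : sin (acos (x / r)) = `|y| / r.
  rewrite sin_acos// (_ : 1 - _ = (`|y| / r) ^+ 2).
    by rewrite sqrtr_sqr ger0_norm// divr_ge0// ltW.
  rewrite !expr_div_n real_normK ?num_real//.
  have -> : y ^+ 2 = r ^+ 2 - x ^+ 2 by rewrite rE; ring.
  by field.
have a0 := acos_ge0 x1; have api := acos_lepi x1; have pi0 := pi_ge0 R.
have [y0|/ltW y0] := leP 0 y.
  exists (acos (x / r)); first by apply/andP; split; lra.
  rewrite /circle_param ca sa ger0_norm//.
  by congr (_ +i* _)%C; field.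
exists (2 * pi - acos (x / r)); first by apply/andP; split; lra.
have e : 2 * pi - acos (x / r) = - acos (x / r) + pi *+ 2 by rewrite mulr_natl
  addrC.
rewrite /circle_param e cosD2pi sinD2pi cosN sinN ca sa ler0_norm//.
by congr (_ +i* _)%C; field.
Qed.

End CircleParam.

Section Eigenvalues.
Variables (R : realType) (N : nat) (s : 'S_N) (z : 'I_N -> R[i]).
Hypothesis z_neq0 : forall j, z j != 0.

Definition cycle_mean (x : 'I_N -> R) (k : 'I_N) : R :=
  (\sum_(j in porbit s k) x j) / #|porbit s k|%:R.

Let mean := cycle_mean (fun j => ln (normc (z j))).

Let normc_gt0 j : 0 < normc (z j).
Proof.
rewrite lt_neqAle; apply/andP; split; last by case: (z j) => x y;
  exact: sqrtr_ge0.
by apply: contra_neq (z_neq0 j) => /esym/eq0_normc.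
Qed.

Let card_gt0 k : 0 < #|porbit s k|%:R :> R.
Proof. by rewrite ltr0n lt0n card_porbit_neq0. Qed.

Let normc_prod k :
  normc (\prod_(j in porbit s k) z j) = expR (mean k) ^+ #|porbit s k|.
Proof.
rewrite -expRM_natr /mean /cycle_mean mulfVK ?gt_eqF// expR_sum.
rewrite (big_morph _ (@normcM R) (@normc1 R)).
by apply: eq_bigr => j _; rewrite lnK// posrE.
Qed.

(** The root at position [p] of a cycle of length [l] gets the argument
    [(phi + 2 pi p) / l], with [phi] in [0, 2 pi] an argument of the product
    of the weights; this puts one root in each of the [l] arcs. *)
Lemma cycle_mx_eigenvalues : exists lam : 'I_N -> R[i],
  char_poly (cycle_mx s z) = \prod_k ('X - (lam k)%:P) /\
  forall k, exists2 t,
    2 * pi / #|porbit s k|%:R * (cycle_pos s k)%:R <= t <=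
    2 * pi / #|porbit s k|%:R * (cycle_pos s k).+1%:R &
    lam k = circle_param (expR (mean k)) t.
Proof.
have /choice[phi phiP] : forall k, exists phi, 0 <= phi <= 2 * pi /\
    \prod_(j in porbit s k) z j =
    circle_param (normc (\prod_(j in porbit s k) z j)) phi.
  move=> k; have [phi ? ?] := polar_decomposition (\prod_(j in porbit s k) z j).
  by exists phi.
pose t k := (phi (cycle_root s k) + 2 * pi * (cycle_pos s k)%:R) / #|porbit s
  k|%:R.
exists (fun k => circle_param (expR (mean k)) (t k)); split.
  apply: char_poly_cycle_mx => //.
    move=> k; rewrite circle_paramX -normc_prod.
    rewrite /t mulrC mulfVK ?gt_eqF// circle_param_periodic.
    have [_] := phiP (cycle_root s k).
    by rewrite porbit_root => <-.
  move=> k k' kk'; rewrite /t /mean /cycle_mean (eq_porbit kk') (eq_cycle_root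
    kk').
  have lt_k' := ltn_cycle_pos s k'; rewrite (eq_porbit kk') in lt_k'.
  have lt_k := ltn_cycle_pos s k; have l0 := card_gt0 k.
  set l := #|porbit s k|%:R in l0 *; have pi0 := pi_gt0 R.
  have pi2 : 0 < 2 * pi :> R by rewrite mulr_gt0.
  set a := cycle_pos s k'; set b := cycle_pos s k => e.
  apply: (cycle_pos_inj kk'); rewrite -/a -/b.
  have : (phi (cycle_root s k) + 2 * pi * a%:R) / l =
         (phi (cycle_root s k) + 2 * pi * b%:R) / l.
    apply: circle_param_inj e; first exact: expR_gt0.
    rewrite -mulrBl opprD addrACA subrr add0r -mulrBr -mulrA normrM (gtr0_norm
      pi2).
    rewrite gtr_pMr// normrM normfV (gtr0_norm l0) ltr_pdivrMr// mul1r
      ltr_norml.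
    have al : a%:R < l by rewrite ltr_nat.
    have bl : b%:R < l by rewrite ltr_nat.
    have a_ge0 : 0 <= a%:R :> R by [].
    have b_ge0 : 0 <= b%:R :> R by [].
    by apply/andP; split; lra.
  move/(mulIf (invr_neq0 (lt0r_neq0 l0))) => /addrI /(mulfI (lt0r_neq0 pi2)).
  by move/eqP; rewrite eqr_nat => /eqP.
move=> k; exists (t k) => //.
have [/andP[p0 p2] _] := phiP (cycle_root s k).
rewrite /t mulrAC [X in _ <= _ <= X]mulrAC !ler_pM2r ?invr_gt0//.
by rewrite lerDr p0 /= -(natr1 (cycle_pos s k)) (mulrDr (2 * pi) _ 1) mulr1
  addrC lerD2l.
Qed.

End Eigenvalues.

(** * A deterministic criterion for weak convergence *)

Section SpectralConvergence.
Variables (R : realType) (f : R[i] -> R) (C m : R).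
Hypothesis cf : continuous f.
Hypothesis fC : forall x, `|f x| <= C.

Let C_ge0 : 0 <= C. Proof. exact: le_trans (fC 0). Qed.

Let mf : measurable_fun setT f.
Proof. exact: measurable_continuous_complex. Qed.

Let g (t : R) := f (circle_param (expR m) t).

Let mg : measurable_fun setT g.
Proof. exact: (measurableT_comp mf (measurable_circle_param (expR m))). Qed.

Let U : probability (measurableTypeR R) R := uniform_prob (lt0_2pi R).
Let I : R := fine (\int[U]_t (g t)%:E)%E.

Let integrable_g : U.-integrable setT (EFin \o g).
Proof.
apply: measurable_bounded_integrable => //.
  by rewrite [X in (X < _)%E]probability_setT ltry.
exists C; split; first exact: num_real.
by move=> M CM t _; exact: le_trans (fC _) (ltW CM).
Qed.

Let IE : (\int[U]_t (g t)%:E = I%:E)%E.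
Proof. by rewrite fineK//; exact: integrable_fin_num integrable_g. Qed.

Let I_le : `|I| <= C.
Proof.
rewrite -lee_fin -abse_EFin -IE.
apply: (le_trans (le_abse_integral _ _ _)) => //; first exact/measurable_EFinP.
apply: (@le_trans _ _ (\int[U]_t C%:E)%E).
  apply: ge0_le_integral => //.
  - by apply/measurable_EFinP; exact: measurableT_comp.
  - by move=> t _; rewrite lee_fin; exact: fC.
by rewrite integral_cst//= [X in (_ * X)%E]probability_setT mule1.
Qed.

Lemma integral_uniform_circle :
  (\int[uniform_circle (expR m)]_x (f x)%:E = I%:E)%E.
Proof.
rewrite -IE /uniform_circle.
apply: (etrans (integral_distribution (X := circle_param (expR m)) _ _)) => //.
exact/measurable_EFinP.
Qed.

Section Fixed.
Variables (n : nat) (s : 'S_n.+1) (z : 'I_n.+1 -> R[i]) (lam : 'I_n.+1 -> R[i]).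
Variables (eps del : R).
Hypothesis del0 : 0 < del.
Hypothesis eps0 : 0 <= eps.
Hypothesis unif : forall a s t, 0 <= s <= 2 * pi ->
    `|a - m| <= del -> `|t - s| <= del ->
    `|f (circle_param (expR a) t) - f (circle_param (expR m) s)| <= eps.
Let mean := cycle_mean s (fun j => ln (normc (z j))).
Hypothesis lamP : forall k, exists2 t,
    2 * pi / #|porbit s k|%:R * (cycle_pos s k)%:R <= t <=
    2 * pi / #|porbit s k|%:R * (cycle_pos s k).+1%:R &
    lam k = circle_param (expR (mean k)) t.

Lemma long_cycle_average k : `|mean k - m| <= del ->
  2 * pi / #|porbit s k|%:R <= del ->
  `|\sum_(j in porbit s k) f (lam j) - #|porbit s k|%:R * I| <=
    eps * #|porbit s k|%:R.
Proof.
move=> mean_le l_le.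
set l := #|porbit s k| in l_le *.
have l0 : (0 < l)%N by rewrite lt0n card_porbit_neq0.
have lR : 0 < l%:R :> R by rewrite ltr0n.
rewrite big_porbit -/l.
pose v (a : 'I_l) := f (lam (iter a s (cycle_root s k))).
have pi2 := lt0_2pi R.
have := @riemann_sum_uniform R g l v eps C l0 mg (fun t => fC _).
set h := 2 * pi / l%:R in l_le *.
have h0 : 0 < h by rewrite divr_gt0.
have hl : h * l%:R = 2 * pi by rewrite mulfVK// gt_eqF.
move=> H; have : `|l%:R^-1 * \sum_k0 v k0 - I| <= eps.
  apply: H => a t /andP[at_ ta].
  have [t' ] := lamP (iter a s (cycle_root s k)).
  rewrite (eq_porbit (iter_in_porbit s a k)) -/l cycle_pos_iter// -/h.
  move=> /andP[at' ta'] e.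
  have -> : v a = f (circle_param (expR (mean k)) t').
    by rewrite /v e /mean /cycle_mean (eq_porbit (iter_in_porbit s a k)).
  have ha1 : h * a.+1%:R = h * a%:R + h.
    by rewrite -(natr1 a) (mulrDr h _ 1) mulr1.
  apply: unif => //.
    apply/andP; split.
      by apply: le_trans at_; apply: mulr_ge0 => //; exact: ltW.
    by apply: (le_trans ta); rewrite -hl ler_wpM2l ?ler_nat// (ltW h0).
  rewrite ha1 in ta ta'; rewrite ler_norml; apply/andP; split; lra.
have -> : \sum_(a < l) f (lam (iter a s (cycle_root s k))) - l%:R * I =
    (l%:R^-1 * \sum_a v a - I) * l%:R.
  by rewrite mulrBl mulrAC mulVf ?mul1r ?gt_eqF// [I * _]mulrC.
by rewrite normrM (gtr0_norm lR) ler_pM2r.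
Qed.

(** Long cycles with a small mean fluctuation contribute [eps]. For the others
    the trivial bound [2 C l] is charged to the cycle itself if [l] is at most
    [2 pi / del], and to its sum if the mean fluctuation exceeds [del]. *)
Lemma eigenvalue_average_close :
  `|n.+1%:R^-1 * \sum_k f (lam k) - I| <=
  eps + 2 * C / del * ((2 * pi * #|porbits s|%:R +
     cycle_sums s (fun j => ln (normc (z j)) - m)) / n.+1%:R).
Proof.
pose x j := ln (normc (z j)) - m.
have N0 : 0 < n.+1%:R :> R by rewrite ltr0n.
have pi2 := lt0_2pi R.
have -> : n.+1%:R^-1 * \sum_k f (lam k) - I =
    (\sum_(c in porbits s) (\sum_(k in c) f (lam k) - #|c|%:R * I)) / n.+1%:R.
  rewrite sumrB sum_porbits -mulr_suml.
  have -> : \sum_(c in porbits s) (#|c|%:R : R) = n.+1%:R.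
    under eq_bigr do rewrite -sumr_const.
    by rewrite (sum_porbits s (fun=> 1)) sumr_const card_ord.
  by rewrite mulrBl mulrAC divff ?mul1r ?gt_eqF// mulrC.
rewrite normrM normfV (gtr0_norm N0) ler_pdivrMr//.
have -> : (eps + 2 * C / del * ((2 * pi * #|porbits s|%:R + cycle_sums s x)
  / n.+1%:R))
    * n.+1%:R = \sum_(c in porbits s)
    (eps * #|c|%:R + 2 * C / del * (2 * pi + `|\sum_(j in c) x j|)).
  rewrite big_split/= -!mulr_sumr big_split/= sumr_const -/(cycle_sums s x).
  have -> : \sum_(c in porbits s) (#|c|%:R : R) = n.+1%:R.
    under eq_bigr do rewrite -sumr_const.
    by rewrite (sum_porbits s (fun=> 1)) sumr_const card_ord.
  rewrite mulrDl; congr (_ + _).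
  by rewrite -[LHS]mulrA (mulfVK (lt0r_neq0 N0)) mulr_natr.
apply: (le_trans (ler_norm_sum _ _ _)); apply: ler_sum => _ /imsetP[k _ ->].
set l := #|porbit s k|.
have lR : 0 < l%:R :> R by rewrite ltr0n lt0n card_porbit_neq0.
have Sx : \sum_(j in porbit s k) x j = l%:R * (mean k - m).
  rewrite /x sumrB sumr_const mulrBr /mean /cycle_mean -/l.
  by rewrite mulrC mulfVK ?gt_eqF// mulr_natl.
have Sabs : `|\sum_(j in porbit s k) x j| = l%:R * `|mean k - m|.
  by rewrite Sx normrM gtr0_norm.
have D0 : 0 <= 2 * C / del by rewrite divr_ge0 ?mulr_ge0// ltW.
have crude : `|\sum_(j in porbit s k) f (lam j) - l%:R * I| <= 2 * C / del
  * (del * l%:R).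
  have -> : 2 * C / del * (del * l%:R) = C * l%:R + l%:R * C.
    by field; rewrite gt_eqF.
  apply: le_trans (ler_normB _ _) _; apply: lerD.
    apply: (le_trans (ler_norm_sum _ _ _)).
    apply: (@le_trans _ _ (\sum_(j in porbit s k) C)); first exact: ler_sum.
    by rewrite sumr_const mulr_natr.
  by rewrite normrM (gtr0_norm lR) ler_pM2l.
have [le1|/ltW lt1] := leP (`|mean k - m|) del; last first.
  apply: (le_trans crude); rewrite -[leLHS]add0r; apply: lerD.
    by apply: mulr_ge0 => //; exact: ltW.
  rewrite ler_wpM2l// Sabs mulrC -[leLHS]add0r lerD ?(ltW pi2)//.
  by rewrite ler_pM2l.
have [le2|/ltW lt2] := leP (2 * pi / l%:R) del; last first.
  apply: (le_trans crude); rewrite -[leLHS]add0r; apply: lerD.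
    by apply: mulr_ge0 => //; exact: ltW.
  rewrite ler_wpM2l// -[leLHS]addr0 lerD//.
  by rewrite -ler_pdivlMr.
apply: (le_trans (long_cycle_average le1 le2)).
by rewrite lerDl mulr_ge0// addr_ge0// ltW.
Qed.

End Fixed.

Lemma cvg_spectral_integral (s : forall n, 'S_n.+1) (z : forall n, 'I_n.+1
  -> R[i]) :
  (forall n j, z n j != 0) ->
  (forall e, 0 < e -> exists n0, forall n, (n0 <= n)%N ->
     #|porbits (s n)|%:R + cycle_sums (s n) (fun j => ln (normc (z n j)) - m) <=
       e * n.+1%:R) ->
  (\int[spectral_prob (cycle_mx (s n) (z n))]_x (f x)%:E)%E @[n --> \oo] -->
  (\int[uniform_circle (expR m)]_x (f x)%:E)%E.
Proof.
move=> z0 small; rewrite integral_uniform_circle.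
pose lam n := projT1 (cid (cycle_mx_eigenvalues (s n) (z0 n))).
have lamP n := projT2 (cid (cycle_mx_eigenvalues (s n) (z0 n))).
rewrite -/(lam _) in lamP.
under eq_fun => n do rewrite (integral_spectral_prob (proj1 (lamP n)) mf).
apply: cvg_EFin; first by near=> n.
apply/cvgrPdist_le => e e0.
have e2 : 0 < e / 2 by rewrite divr_gt0.
have [del del0 unif] := polar_uniform_continuity m cf e2.
have pi2 := lt0_2pi R.
(* The smallness is asked relative to [A + 1] rather than [A], because [A]
   vanishes when [C] does. *)
pose A := 2 * C / del * (2 * pi + 1).
have A0 : 0 <= A by rewrite mulr_ge0 ?divr_ge0 ?mulr_ge0 ?addr_ge0 ?(ltW del0)
  ?(ltW pi2).
have A1 : 0 < A + 1 by rewrite ltr_wpDl.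
have [n0 Hn0] := small _ (divr_gt0 e2 A1).
near=> n; rewrite distrC.
have nn0 : (n0 <= n)%N by near: n; exact: nbhs_infty_ge.
have N0 : 0 < n.+1%:R :> R by rewrite ltr0n.
apply: le_trans (eigenvalue_average_close del0 (ltW e2) unif (proj2 (lamP n)))
  _.
rewrite [leRHS](splitr e) lerD2l.
set S := cycle_sums _ _; have S0 : 0 <= S by apply: sumr_ge0.
have {nn0}/Hn0 := nn0; rewrite -/S; set c := #|porbits _|%:R => le.
have c0 : 0 <= c by [].
have -> : e / 2 = (A + 1) * (e / 2 / (A + 1)) by field; rewrite gt_eqF.
apply: (@le_trans _ _ (A * (e / 2 / (A + 1)))); last first.
  by rewrite ler_pM2r ?divr_gt0// lerDl.
set q := e / 2 / (A + 1) in le *.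
have -> : A * q = 2 * C / del * ((2 * pi + 1) * q) by rewrite /A mulrA.
apply: ler_wpM2l; first by rewrite divr_ge0 ?mulr_ge0 ?(ltW del0).
rewrite ler_pdivrMr// -[leRHS]mulrA; apply: (@le_trans _ _ ((2 * pi + 1) * (c
  + S))).
  by move: (2 * pi) pi2 => p p0; have := mulr_ge0 (ltW p0) S0; lra.
by apply: ler_wpM2l => //; rewrite addr_ge0// ltW.
Unshelve. all: by end_near. Qed.

End SpectralConvergence.

(** * From the model to the law of the matrices *)

Lemma continuous_normc (R : realType) :
  continuous (fun x : R[i] => normc x : R).
Proof.
move=> x; apply/(@cvgrPdist_lt _ _ _ (nbhs x) (nbhs_filter x)) => e e0.
have eC : 0 < e%:C%C by rewrite ltcR.
apply/nbhs_ballP; exists e%:C%C => //= y; rewrite /ball/= normc_def ltcR => lt.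
have nE (u v : R[i]) : normc u <= normc (u - v) + normc v.
  by rewrite -{1}(subrK v u) le_normcD.
have dE : normc (x - y) < e by case: (x - y) lt => a b.
have := nE x y; have := nE y x; rewrite -opprB normcN => h1 h2.
by rewrite ltr_norml; apply/andP; split; lra.
Qed.

Lemma measurable_normc (R : realType) : measurable_fun setT (fun x : R[i] =>
  normc x : R).
Proof. by apply: measurable_continuous_complex; exact: continuous_normc. Qed.

Lemma measurable_log_modulus (R : realType) (m : R) :
  measurable_fun setT (fun x : R[i] => ln (normc x) - m).
Proof.
apply: measurable_funB => //; apply: measurableT_comp => //.
exact: measurable_normc.
Qed.

Section MatrixSequences.
Variables (R : realType) (m : R).

(** The nonzero entry of row [j], when [A] is a weighted permutation matrix
    with permutation [s]. *)
Definition mx_weight n (s : 'S_n.+1) (A : 'M[R[i]]_n.+1) (j : 'I_n.+1) : R[i] :=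
  A j (s^-1 j)%g.

Definition cycle_shaped n (s : 'S_n.+1) (A : 'M[R[i]]_n.+1) : Prop :=
  A = cycle_mx s (mx_weight s A) /\ forall j, mx_weight s A j != 0.

Definition cycle_fluctuation n (s : 'S_n.+1) (A : 'M[R[i]]_n.+1) : R :=
  #|porbits s|%:R + cycle_sums s (fun j => ln (normc (mx_weight s A j)) - m).

Lemma cycle_shaped_unique n (s s' : 'S_n.+1) A :
  cycle_shaped s A -> cycle_shaped s' A -> s = s'.
Proof.
move=> [_ A0] [A' _]; apply/permP => k.
have := A0 (s k); rewrite /mx_weight permK A' mxE.
by case: (s k =P s' k) => // _; rewrite mulr0n eqxx.
Qed.

(** The hypotheses of [cvg_spectral_integral], expressed with countably many
    conditions on the entries so as to be measurable. *)
Definition concentrating : set (mxseq R) :=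
  [set M | (forall n, exists s, cycle_shaped s (M n)) /\
    forall k, exists n0, forall n, (n0 <= n)%N -> exists2 s, cycle_shaped s (M
      n) &
      cycle_fluctuation s (M n) <= k.+1%:R^-1 * n.+1%:R].

Lemma weak_cvg_concentrating (M : mxseq R) : concentrating M ->
  weak_cvg (fun n => spectral_prob (M n)) (uniform_circle (expR m)).
Proof.
move=> [shape fluct] f cf bf.
pose s n := projT1 (cid (shape n)).
have sP n : cycle_shaped (s n) (M n) by exact: projT2 (cid (shape n)).
pose z n := mx_weight (s n) (M n).
have [C [_ fC]] := bf.
have fC' x : `|f x| <= `|C| + 1.
  by apply: fC => //; rewrite (le_lt_trans (ler_norm _))// ltrDl.
have ME : M = (fun n => cycle_mx (s n) (z n)).
  by apply: functional_extensionality_dep => n; exact: (sP n).1.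
rewrite ME; apply: (cvg_spectral_integral cf fC') => [n j|e e0].
  exact: (sP n).2.
pose k := Num.truncn e^-1.
have ke : k.+1%:R^-1 <= e.
  rewrite -[leRHS]invrK lef_pV2 ?posrE ?invr_gt0//.
  have ei : 0 <= e^-1 by rewrite invr_ge0 ltW.
  by have /andP[_ /ltW] := truncn_itv ei.
have [n0 H] := fluct k; exists n0 => n /H[s' s'P le].
have es : s' = s n := cycle_shaped_unique s'P (sP n).
by rewrite es in le; apply: (le_trans le); rewrite ler_pM2r.
Qed.

Let entry_measurable n (i j : 'I_n.+1) :
  measurable_fun [set: mxseq R] (fun M => M n i j).
Proof.
move=> _ B mB; rewrite setTI; apply: sub_sigma_algebra.
by exists n, i, j, B.
Qed.

Lemma measurable_concentrating : measurable concentrating.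
Proof.
(* The shape of a matrix is a condition on which entries vanish. *)
have mzero n (i j : 'I_n.+1) : measurable [set M : mxseq R | M n i j = 0].
  rewrite (_ : [set M | _] = [set M : mxseq R | normc (M n i j) <= 0]).
    apply: (@measurable_ler_set _ _ _ (fun M : mxseq R => normc (M n i j))
      (cst 0)) => //.
    exact: (measurableT_comp (@measurable_normc R) (entry_measurable i j)).
  apply/seteqP; split => M /= => [->|le]; first by rewrite normc0.
  apply/eq0_normc/eqP; rewrite eq_le le/=.
  by case: (M n i j) => a b; exact: sqrtr_ge0.
have mshape n (s : 'S_n.+1) : measurable [set M : mxseq R | cycle_shaped s (M
  n)].
  rewrite (_ : [set M | _] =
    (\bigcap_(p : 'I_n.+1 * 'I_n.+1)
       [set M : mxseq R | p.1 = s p.2 \/ M n p.1 p.2 = 0]) `&`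
    (\bigcap_(j : 'I_n.+1) ~` [set M : mxseq R | M n j (s^-1 j)%g = 0])).
    apply: measurableI; apply: fin_bigcap_measurable => //.
    - move=> [i j] _; have [->|ij] := eqVneq i (s j).
        by rewrite (_ : [set M | _] = setT)//; apply/seteqP; split => // M _;
          left.
      rewrite (_ : [set M | _] = [set M : mxseq R | M n i j = 0])//.
      apply/seteqP; split => M /=; last by right.
      by case=> // e; move: ij; rewrite e eqxx.
    - by move=> j _; exact: measurableC.
  apply/seteqP; split => M /=.
    move=> [ME M0]; split => [[i j] _|j _] /=.
      have [->|ij] := eqVneq i (s j); [by left|right].
      by rewrite ME mxE (negPf ij).
    by apply/eqP; exact: M0.
  move=> [H1 H2]; split; last by move=> j; apply/eqP; exact: H2.
  apply/matrixP => i j; rewrite mxE /mx_weight.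
  have [->|ij] := eqVneq i (s j); first by rewrite permK.
  by have [/= e|//] := H1 (i, j) I; rewrite e eqxx in ij.
have mfluct n (s : 'S_n.+1) (t : R) :
    measurable [set M : mxseq R | cycle_fluctuation s (M n) <= t].
  apply: (@measurable_ler_set _ _ _
    (fun M : mxseq R => cycle_fluctuation s (M n)) (cst t)) => //.
  apply: measurable_funD => //; apply: measurable_cycle_sums => j.
  exact: (measurableT_comp (measurable_log_modulus m) (entry_measurable _ _)).
rewrite (_ : concentrating =
  (\bigcap_n \bigcup_(s : 'S_n.+1) [set M : mxseq R | cycle_shaped s (M n)]) `&`
  (\bigcap_k \bigcup_n0 \bigcap_(n in [set n | (n0 <= n)%N])
     \bigcup_(s : 'S_n.+1) ([set M : mxseq R | cycle_shaped s (M n)] `&`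
       [set M : mxseq R | cycle_fluctuation s (M n) <= k.+1%:R^-1 * n.+1%:R]))).
  apply: measurableI.
    apply: bigcap_measurableType => n _; apply: fin_bigcup_measurable => [|s
      _] //; exact: finite_finset.
  apply: bigcap_measurableType => k _; apply: bigcup_measurable => n0 _.
  apply: bigcap_measurableType => n _.
  apply: fin_bigcup_measurable => [|s _]; first exact: finite_finset.
  exact: measurableI.
apply/seteqP; split => M /=.
  move=> [H1 H2]; split => [n _|k _].
    by have [s sP] := H1 n; exists s.
  have [n0 H] := H2 k; exists n0 => // n /= nn0.
  by have [s ? ?] := H n nn0; exists s.
move=> [H1 H2]; split => [n|k].
  by have [s _ sP] := H1 n I; exists s.
have [n0 _ H] := H2 k I; exists n0 => n nn0.
by have [s _ [? ?]] := H n nn0; exists s.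
Qed.

End MatrixSequences.

Section ModelMatrices.
Context d (T : measurableType d) (R : realType) (P : probability T R).
Variables (theta m : R) (L : probability R[i] R).
Variables (sigma : forall n, T -> 'S_n.+1) (z : nat -> {RV P >-> R[i]}).
Hypothesis theta_gt0 : 0 < theta.
Hypothesis model : ewens_model theta L P sigma z.

Let F (w : T) : mxseq R := fun n => cycle_mx (sigma n w) (fun j => z j w).

Lemma measurable_model_mx : measurable_fun setT F.
Proof.
apply: (@measurability _ _ _ _ setT F (@mx_cylinders R)) => //.
move=> _ [_ [n [i [j [B [mB ->]]]]] <-]; rewrite setTI.
rewrite (_ : _ @^-1` _ = \bigcup_(s : 'S_n.+1) (sigma n @^-1` [set s] `&`
    [set w | B (z i w *+ (i == s j))])).
  apply: fin_bigcup_measurable => [|s _]; first exact: finite_finset.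
  apply: measurableI; first exact: (ewens_model_measurable model).
  have [ij|ij] := eqVneq i (s j).
    by rewrite -[X in measurable X]setTI; exact: measurable_funP.
  have [B0|B0] := pselect (B 0).
    by rewrite (_ : [set w | _] = setT)//; apply/seteqP; split.
  by rewrite (_ : [set w | _] = set0)//; apply/seteqP; split.
apply/seteqP; split => w /=; rewrite /F ?mxE.
  by move=> Bw; exists (sigma n w).
by move=> [s _ [<-]].
Qed.

Hypothesis L_integrable :
  L.-integrable setT (EFin \o (fun x => ln (normc x) - m)).
Hypothesis L_centered : (\int[L]_x (ln (normc x) - m)%:E = 0)%E.

Lemma ae_concentrating : {ae P, forall w, concentrating m (F w)}.
Proof.
have ae1 : {ae P, forall w, forall k, exists n0, forall n, (n0 <= n)%N ->
    #|porbits (sigma n w)|%:R <= (k.+1%:R^-1 / 2) * n.+1%:R :> R}.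
  apply: ae_foralln => k; apply: (ae_card_porbits_le theta_gt0 model).
  by rewrite divr_gt0 ?invr_gt0.
have ae2 : {ae P, forall w, forall k, exists n0, forall n, (n0 <= n)%N ->
    cycle_sums (sigma n w) (fun j => ln (normc (z j w)) - m) <=
      8 * (k.+1%:R^-1 / 16) * n.+1%:R}.
  apply: ae_foralln => k.
  apply: (ae_cycle_sums_le theta_gt0 model L_integrable L_centered).
  by rewrite divr_gt0 ?invr_gt0.
apply: filterS2 ae1 ae2 => w H1 H2.
have weightE n j : mx_weight (sigma n w) (F w n) j = z j w.
  by rewrite /mx_weight /F mxE permKV eqxx.
have shape n : cycle_shaped (sigma n w) (F w n).
  split=> [|j]; last by rewrite weightE (ewens_model_neq0 model).
  by apply/matrixP => i j; rewrite [RHS]mxE weightE /F mxE.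
split=> [n|k]; first by exists (sigma n w).
have [n1 K1] := H1 k; have [n2 K2] := H2 k.
exists (maxn n1 n2) => n; rewrite geq_max => /andP[/K1 le1 /K2 le2].
exists (sigma n w) => //; rewrite /cycle_fluctuation.
under [X in cycle_sums _ X]eq_fun do rewrite weightE.
move: le1 le2; set S := cycle_sums _ _; set c := #|_|%:R.
set q := k.+1%:R^-1; set N := n.+1%:R; lra.
Qed.

Lemma prob_concentrating :
  P [set w | concentrating m (F w)] = 1%E.
Proof.
have mA : measurable [set w | concentrating m (F w)].
  rewrite -[X in measurable X]setTI.
  exact: (measurable_model_mx measurableT (measurable_concentrating m)).
have A0 : P (~` [set w | concentrating m (F w)]) = 0%E.
  by apply: measure_negligible; [exact: measurableC|exact: ae_concentrating].
have := probability_setC P (measurableC mA); rewrite setCK A0 => ->.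
by rewrite sube0.
Qed.

End ModelMatrices.

Theorem proposition3p1 (R : realType) (theta : R) (theta_gt0 : 0 < theta)
    (L : probability R[i] R) (L_neq0 : L [set 0] = 0%E)
    (Q : probability (mxseq R) R) (Q_law : ewens_mx_law theta L Q)
    (d : measure_display) (T : measurableType d) (P : probability T R)
    (M : {RV P >-> mxseq R})
    (M_law : forall A : set (mxseq R), measurable A -> distribution P M A = Q A)
    (d' : measure_display) (T' : measurableType d') (P' : probability T' R)
    (Z : {RV P' >-> R[i]})
    (Z_law : forall A : set R[i], measurable A -> distribution P' Z A = L A)
    (Z_integrable :
      P'.-integrable setT (fun w => (ln (normc (Z w)))%:E)) :
  {ae P, forall w, weak_cvg (fun n => spectral_prob (M w n))
    (uniform_circle (expR (fine ('E_P'[fun w' => ln (normc (Z w'))])%E)))}.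
Proof.
set m := fine _.
have [d0 [T0 [P0 [sigma [z [model QE]]]]]] := Q_law.
pose h (x : R[i]) := ln (normc x).
have mh : measurable_fun setT h by apply: measurableT_comp => //;
  exact: measurable_normc.
have [ih hE] := integral_of_law Z_law mh Z_integrable.
have mE : (\int[L]_x (h x)%:E = m%:E)%E.
  rewrite hE /m unlock fineK//; exact: integrable_fin_num Z_integrable.
have iX : L.-integrable setT (EFin \o (fun x => ln (normc x) - m)).
  have -> : EFin \o (fun x => ln (normc x) - m) =
      (fun x => (EFin \o h) x - (cst m%:E) x)%E by [].
  by apply: integrableB => //; exact: finite_measure_integrable_cst.
have X0 : (\int[L]_x (ln (normc x) - m)%:E = 0)%E.
  under eq_integral do rewrite EFinB.
  rewrite (integralB _ ih)//; last exact: finite_measure_integrable_cst.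
  by rewrite mE integral_cst//= probability_setT mule1 subee.
have mA := measurable_concentrating m.
have QA : Q (concentrating m) = 1%E.
  by rewrite QE//; exact: (prob_concentrating theta_gt0 model iX X0).
have mB : measurable (M @^-1` concentrating m).
  by rewrite -[X in measurable X]setTI; exact: measurable_funP.
have PB : P (~` (M @^-1` concentrating m)) = 0%E.
  have PB1 : P (M @^-1` concentrating m) = 1%E by rewrite -QA -M_law.
  by rewrite probability_setC// PB1 subee.
exists (~` (M @^-1` concentrating m)); split => //; first exact: measurableC.
move=> w /= nw cw; apply: nw; exact: weak_cvg_concentrating cw.
Qed.
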